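(* Let $p>2$ be a prime and let $a$ be a primitive root modulo $p$. Consider the group \[ G=\langle \sigma,\tau \mid \sigma^p=\tau^{p-1}=e,\ \tau\sigma\tau^{-1}=\sigma^a\rangle\simeq \mathbb{Z}/p\mathbb{Z}\rtimes\mathbb{Z}/(p-1)\mathbb{Z}, \] and let $X=X(G,\{\sigma,\tau\})$ be the associated Cayley graph. Then, for every prime $q$, every layer $X_m$ ($m\ge 0$) of the constant $\mathbb{Z}_q$-tower of $X$ has defect $\delta(X_m)=0$. Moreover, for every prime $q$, $\mu_q(\mathcal{BF}(X_\infty))=0$ and \[ \lambda_q(\mathcal{BF}(X_\infty))=\begin{cases}(p-1)\bigl(q^{\operatorname{val}_q(p-1)}-1\bigr) & \text{if } q\mid p-1,\\ 0 & \text{if } q\nmid p-1,\end{cases} \] where $\operatorname{val}_q$ is the $q$-adic valuation and $X_\infty$ refers to the constant $\mathbb{Z}_q$-tower of $X$.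
   Context: A digraph $X$ has a vertex set $V(X)$ and a set $E(X)$ of directed edges (loops and multiple edges allowed), each edge $e$ having an origin $o(e)$ and a terminus $t(e)$. For a group $G$ and a generating set $S$ of $G$, the (directed) Cayley graph $X(G,S)$ has vertex set $G$ and, for every $g\in G$ and $s\in S$, one directed edge from $g$ to $gs$. Constant tower: for a finite digraph $X$ and a prime $q$, let $\Gamma\simeq\mathbb{Z}_q$ (written multiplicatively) have topological generator $\theta$, and let $\theta_m$ be the image of $\theta$ in $\Gamma/\Gamma^{q^m}\simeq\mathbb{Z}/q^m\mathbb{Z}$. The layer $X_m$ of the constant $\mathbb{Z}_q$-tower has vertex set $V(X)\times\Gamma/\Gamma^{q^m}$, edge set $E(X)\times\Gamma/\Gamma^{q^m}$, and the edge $(e,g)$ goes from $(o(e),g)$ to $(t(e),g\theta_m)$. (For the graph $X$ considered here all layers $X_m$ are connected.) The group $\Gamma/\Gamma^{q^m}$ acts on $X_m$ by multiplication on the second component. Defect: the adjacency matrix $A_X=[a_{ij}]$ has $a_{ij}$ equal to the number of edges from $v_i$ to $v_j$. Let $a(X)$ and $b(X)$ be respectively the algebraic and the geometric multiplicity of $1$ as an eigenvalue of $A_X$. The defect is $\delta(X)=a(X)-b(X)$. Bowen--Franks group: $\operatorname{Div}(X)$ is the free abelian group on $V(X)$; the adjacency operator $A_X$ acts on it by sending $v$ to $\sum_{e:\,o(e)=v} t(e)$. Set $\mathcal{BF}(X)=\operatorname{Div}(X)/(\mathrm{Id}-A_X)\operatorname{Div}(X)$. Put $\mathcal{BF}(X_\infty)=\varprojlim_m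 \mathcal{BF}(X_m)\otimes\mathbb{Z}_q$, the transition maps being induced by the projections $X_{m+1}\to X_m$ on vertices. It is a finitely generated module over $\Lambda=\mathbb{Z}_q\llbracket\Gamma\rrbracket\simeq\mathbb{Z}_q\llbracket T\rrbracket$ ($\theta\mapsto 1+T$). Iwasawa invariants: a finitely generated torsion $\Lambda$-module $M$ is pseudo-isomorphic (finite kernel and cokernel) to $\bigoplus_{i}\Lambda/(q^{m_i})\oplus\bigoplus_j\Lambda/(f_j(T))$ with $m_i>0$ and $f_j$ distinguished polynomials (monic, with non-leading coefficients divisible by $q$); then $\mu_q(M)=\sum_i m_i$ and $\lambda_q(M)=\sum_j\deg f_j$. *)

(* Defs.v *)
From HB Require Import structures.
From mathcomp Require Import all_boot all_order all_fingroup all_algebra.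
From mathcomp Require Import algC.
From mathcomp Require Import boolp classical_sets cardinality.
From mathcomp.multinomials Require Import freeg.
From mathcomp Require Import generic_quotient.

Set Implicit Arguments.
Unset Strict Implicit.
Unset Printing Implicit Defensive.

Import GRing.Theory.
Local Open Scope ring_scope.
Local Open Scope quotient_scope.

Record digraph := Digraph {
  vert : finType;
  edge : finType;
  org : edge -> vert;
  ter : edge -> vert
}.

Section Defect.
Variable X : digraph.

Definition adjmx : 'M[algC]_#|vert X| :=
  \matrix_(i, j)
    #|[set e : edge X | (org e == enum_val i) && (ter e == enum_val j)]|%:R.

Definition alg_mult1 : nat := mup 1 (char_poly adjmx).
(* eigenspaces consist of row vectors, on which x |-> x *m adjmx is the
   adjacency operator sending v to the sum of the t(e) with o(e) = v *)
Definition geom_mult1 : nat := \rank (eigenspace adjmx 1).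

(* integer-valued, to avoid the truncated subtraction of nat *)
Definition defect : int := alg_mult1%:Z - geom_mult1%:Z.

End Defect.

(* the pair (g, s) is the edge from g to g s *)
Definition cayley (gT : finGroupType) (S : {set gT}) : digraph :=
  @Digraph gT {x : gT * gT | x.2 \in S}
    (fun e => (val e).1) (fun e => ((val e).1 * (val e).2)%g).

Definition derived (X : digraph) (A : finZmodType) (th : A) : digraph :=
  @Digraph (vert X * A)%type (edge X * A)%type
    (fun e => (org e.1, e.2)) (fun e => (ter e.1, e.2 + th)).

(* Gamma / Gamma^(q^m), written additively and identified with Z/q^m by sending
   the image of theta to 1; 'Z_(q ^ m) would be Z/2 when m = 0 *)
Definition Gam (q m : nat) : finZmodType := 'I_(q ^ m).-1.+1.
Definition theta_ (q m : nat) : Gam q m := inZp 1.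
Definition Gam_proj (q m : nat) (g : Gam q m.+1) : Gam q m := inZp (val g).

Definition layer (X : digraph) (q m : nat) : digraph :=
  derived X (theta_ q m).

Section Div.
Variable V : finType.

(* V is finite, so this is the free abelian group on V, with basis vtx *)
Definition Div : zmodType := {ffun V -> int}.

Definition vtx (v : V) : Div := [ffun w => (w == v)%:R].

Variables (P : zmodType) (F : V -> P).

Definition divext (D : Div) : P := \sum_(v : V) F v *~ D v.

Fact divext_is_zmod_morphism : zmod_morphism divext.
Proof.
move=> D1 D2; rewrite /divext -sumrB; apply: eq_bigr => v _.
by rewrite !ffunE mulrzBr.
Qed.
HB.instance Definition _ :=
  GRing.isZmodMorphism.Build Div P divext divext_is_zmod_morphism.

Lemma divext_vtx v : divext (vtx v) = F v.
Proof.
rewrite /divext (bigD1 v) //= ffunE eqxx big1 ?addr0 // => w /negPf nwv.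
by rewrite ffunE nwv mulr0z.
Qed.

End Div.

Lemma divext_comp (V : finType) (P Q : zmodType) (F : V -> P)
    (f : {additive P -> Q}) (D : Div V) :
  f (divext F D) = divext (f \o F) D.
Proof. by rewrite raddf_sum; apply: eq_bigr => v _; rewrite raddfMz. Qed.

Lemma eq_divext (V : finType) (P : zmodType) (F G : V -> P) :
  F =1 G -> divext F =1 divext G.
Proof. by move=> FG D; apply: eq_bigr => v _; rewrite FG. Qed.

Section BowenFranks.
Variable X : digraph.

Definition adj : Div (vert X) -> Div (vert X) :=
  divext (fun v => \sum_(e : edge X | org e == v) vtx (ter e)).

HB.instance Definition _ := GRing.Additive.on adj.

Definition bf_rel : {pred Div (vert X)} :=
  fun D => `[< exists D', D = D' - adj D' >].

Fact bf_rel_closed : zmod_closed bf_rel.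
Proof.
split; first by apply/asboolP; exists 0; rewrite raddf0 subrr.
move=> _ _ /asboolP[D1 ->] /asboolP[D2 ->]; apply/asboolP; exists (D1 - D2).
by rewrite (raddfB adj) /= !opprD addrACA.
Qed.
HB.instance Definition _ :=
  GRing.isZmodClosed.Build (Div (vert X)) bf_rel bf_rel_closed.

Definition BF := Quotient.quot bf_rel.
HB.instance Definition _ := GRing.Zmodule.on BF.
HB.instance Definition _ : ZmodQuotient _ (Quotient.equiv bf_rel) 0 -%R +%R BF :=
  ZmodQuotient.on BF.

End BowenFranks.

(* commuting with the adjacency operators is what makes a vertex map induce a
   map of Bowen-Franks groups *)
Record bfhom (X Y : digraph) := BFHom {
  bfhom_fun :> vert X -> vert Y;
  bfhomP : forall v, divext (fun w => vtx (bfhom_fun w)) (adj (vtx v)) =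
                     adj (vtx (bfhom_fun v))
}.

Section BFMap.
Variables (X Y : digraph) (f : bfhom X Y).

Definition push : Div (vert X) -> Div (vert Y) := divext (fun v => vtx (f v)).
HB.instance Definition _ := GRing.Additive.on push.

Lemma push_adj D : push (adj D) = adj (push D).
Proof.
rewrite /push {2}/adj [RHS]divext_comp /adj divext_comp; apply: eq_divext => v /=.
by have := bfhomP f v; rewrite /adj !divext_vtx.
Qed.

Definition bfmap (x : BF X) : BF Y := \pi_(BF Y) (push (repr x)).

Lemma bfmap_pi D : bfmap (\pi_(BF X) D) = \pi_(BF Y) (push D).
Proof.
apply/eqP; rewrite -Quotient.idealrBE -raddfB /=.
have /asboolP[D' eD] : bf_rel (repr (\pi_(BF X) D) - D).
  by rewrite -[bf_rel _]/(_ \in (@bf_rel X)) Quotient.idealrBE reprK.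
by rewrite eD; apply/asboolP; exists (push D'); rewrite raddfB /= push_adj.
Qed.

Fact bfmap_is_zmod_morphism : zmod_morphism bfmap.
Proof.
move=> x y; rewrite -[x]reprK -[y]reprK -raddfB !bfmap_pi.
by rewrite -raddfB /= -raddfB.
Qed.
HB.instance Definition _ :=
  GRing.isZmodMorphism.Build (BF X) (BF Y) bfmap bfmap_is_zmod_morphism.

End BFMap.

Lemma bfmap_id (X : digraph) (f : bfhom X X) :
  f =1 id -> forall x, bfmap f x = x.
Proof.
move=> fE x; rewrite -[x]reprK bfmap_pi; congr (\pi_(BF X) _).
have fE' : (fun v => vtx (f v)) =1 (fun v => vtx v) by move=> v; rewrite fE.
rewrite /push (eq_divext fE').
apply/ffunP => v; rewrite /divext sum_ffunE (bigD1 v) //= big1 => [|w /negPf wv].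
  by rewrite addr0 ffunMzE ffunE eqxx intz.
by rewrite ffunMzE ffunE eq_sym wv mul0rz.
Qed.

Lemma bfmap_comp (X Y Z : digraph) (f : bfhom Y Z) (g : bfhom X Y)
    (h : bfhom X Z) :
  (forall v, f (g v) = h v) -> forall x, bfmap f (bfmap g x) = bfmap h x.
Proof.
move=> fg x; elim/quotW: x => D; rewrite (bfmap_pi g) !bfmap_pi.
congr (\pi_(BF Z) _); rewrite /push divext_comp; apply: eq_divext => v /=.
by rewrite divext_vtx fg.
Qed.

Section DerivedMaps.
Variables (X : digraph) (A B : finZmodType) (thA : A) (thB : B) (h : A -> B).
Hypothesis hth : forall g, h (g + thA) = h g + thB.

Definition derived_fun (x : vert (derived X thA)) : vert (derived X thB) :=
  (x.1, h x.2).

Lemma adj_derived (C : finZmodType) (th : C) v g :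
  adj (vtx ((v, g) : vert (derived X th))) =
  \sum_(e : edge X | org e == v)
    vtx ((ter e, g + th) : vert (derived X th)).
Proof.
rewrite /adj divext_vtx /=.
rewrite -(pair_big_dep (fun e => org e == v) (fun _ k => k == g)
  (fun e k => vtx ((ter e, k + th) : vert (derived X th)))) /=.
by apply: eq_bigr => e _; rewrite big_pred1_eq.
Qed.

Fact derived_funP v : divext (fun w => vtx (derived_fun w)) (adj (vtx v)) =
  adj (vtx (derived_fun v)).
Proof.
case: v => v g; rewrite !adj_derived raddf_sum /=; apply: eq_bigr => e _.
by rewrite divext_vtx /= /derived_fun /= hth.
Qed.
Definition derived_map : bfhom (derived X thA) (derived X thB) :=
  BFHom derived_funP.
End DerivedMaps.

Section Tensor.
Variables (M N : zmodType).

Definition tgen (m : M) (n : N) : {freeg (M * N)%type / int} := << (m, n) >>.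

Inductive tensor_span : {freeg (M * N)%type / int} -> Prop :=
| tensor_spanDl m m' n :
    tensor_span (tgen (m + m') n - tgen m n - tgen m' n)
| tensor_spanDr m n n' :
    tensor_span (tgen m (n + n') - tgen m n - tgen m n')
| tensor_span0 : tensor_span 0
| tensor_spanB x y : tensor_span x -> tensor_span y -> tensor_span (x - y).

Definition tensor_rel : {pred {freeg (M * N)%type / int}} :=
  fun x => `[< tensor_span x >].

Fact tensor_rel_closed : zmod_closed tensor_rel.
Proof.
split; first by apply/asboolP; apply: tensor_span0.
by move=> x y /asboolP hx /asboolP hy; apply/asboolP; apply: tensor_spanB.
Qed.
HB.instance Definition _ :=
  GRing.isZmodClosed.Build {freeg (M * N)%type / int} tensor_rel
    tensor_rel_closed.

Definition tensor := Quotient.quot tensor_rel.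
HB.instance Definition _ := GRing.Zmodule.on tensor.
HB.instance Definition _ :
    ZmodQuotient _ (Quotient.equiv tensor_rel) 0 -%R +%R tensor :=
  ZmodQuotient.on tensor.
Definition tens (m : M) (n : N) : tensor := \pi_tensor (tgen m n).

Lemma tensDl m m' n : tens (m + m') n = tens m n + tens m' n.
Proof.
apply/eqP; rewrite -raddfD -Quotient.idealrBE opprD addrA.
by apply/asboolP; apply: tensor_spanDl.
Qed.

Lemma tensDr m n n' : tens m (n + n') = tens m n + tens m n'.
Proof.
apply/eqP; rewrite -raddfD -Quotient.idealrBE opprD addrA.
by apply/asboolP; apply: tensor_spanDr.
Qed.

Lemma tens0r n : tens 0 n = 0.
Proof. by apply: (addIr (tens 0 n)); rewrite -tensDl !add0r. Qed.

Lemma tensr0 m : tens m 0 = 0.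
Proof. by apply: (addIr (tens m 0)); rewrite -tensDr !add0r. Qed.

Lemma tens_sumr m (I : finType) (Q : pred I) (F : I -> N) :
  tens m (\sum_(i | Q i) F i) = \sum_(i | Q i) tens m (F i).
Proof. exact: (big_morph (tens m) (tensDr m) (tensr0 m)). Qed.

Lemma tensor_ind (Q : tensor -> Prop) :
    (forall x y, Q x -> Q y -> Q (x + y)) -> (forall x, Q x -> Q (- x)) ->
  (forall m n, Q (tens m n)) -> forall x, Q x.
Proof.
move=> QD QN Qt x; rewrite -[x]reprK -[generic_quotient.repr x]freeg_sumE.
have Q0 : Q 0 by rewrite -(subrr (tens 0 0)); apply: QD; [|apply: QN]; apply: Qt.
rewrite raddf_sum; elim/big_ind: _ => // -[m n] _.
set c := coeff _ _.
rewrite -[c]intz -freegU_mulz raddfMz.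
have Qn k : Q (\pi_tensor << (m, n) >> *+ k).
  by elim: k => // k IH; rewrite mulrS; apply: QD => //; apply: Qt.
by case: c => k; rewrite ?NegzE ?mulrNz -?pmulrn //; apply/QN/Qn.
Qed.

End Tensor.

Section TensorLift.
Variables (M N P : zmodType) (b : M -> N -> P).
Hypotheses (bDl : forall m m' n, b (m + m') n = b m n + b m' n)
           (bDr : forall m n n', b m (n + n') = b m n + b m n').

Let lift0 : {freeg (M * N)%type / int} -> P :=
  fglift (fun k => b k.1 k.2 : zmodule P).

Let lift0B : {morph lift0 : x y / x - y}.
Proof. exact: (lift_is_additive (M := zmodule P)). Qed.

Let lift0_gen m n : lift0 (tgen m n) = b m n.
Proof. by rewrite /lift0 /tgen liftU. Qed.

Let lift0_span x : tensor_span x -> lift0 x = 0.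
Proof.
elim=> [m m' n|m n n'||y z _ y0 _ z0].
- by rewrite !lift0B !lift0_gen bDl addrAC addrK subrr.
- by rewrite !lift0B !lift0_gen bDr addrAC addrK subrr.
- by have := lift0B 0 0; rewrite !subrr.
- by rewrite lift0B y0 z0 subrr.
Qed.

Definition tlift (x : tensor M N) : P := lift0 (generic_quotient.repr x).

Let tlift_pi x : tlift (\pi_(tensor M N) x) = lift0 x.
Proof.
apply/eqP; rewrite -subr_eq0 -lift0B; apply/eqP/lift0_span.
suff /asboolP : tensor_rel (generic_quotient.repr (\pi_(tensor M N) x) - x) by [].
rewrite -[tensor_rel _]/(_ \in (@tensor_rel M N)) Quotient.idealrBE.
by rewrite reprK.
Qed.

Lemma tlift_tens m n : tlift (tens m n) = b m n.
Proof. by rewrite tlift_pi lift0_gen. Qed.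

Fact tlift_is_zmod_morphism : zmod_morphism tlift.
Proof.
move=> x y; rewrite -[x]reprK -[y]reprK !tlift_pi -lift0B -tlift_pi.
by rewrite raddfB.
Qed.

End TensorLift.

Section TensorMap.
Variables (M M' N N' : zmodType).
Variables (f : {additive M -> M'}) (g : {additive N -> N'}).

Let tmapDl m m' n :
  tens (f (m + m')) (g n) = tens (f m) (g n) + tens (f m') (g n).
Proof. by rewrite raddfD tensDl. Qed.

Let tmapDr m n n' :
  tens (f m) (g (n + n')) = tens (f m) (g n) + tens (f m) (g n').
Proof. by rewrite raddfD tensDr. Qed.

Definition tmap : tensor M N -> tensor M' N' :=
  tlift (fun m n => tens (f m) (g n)).
HB.instance Definition _ :=
  GRing.isZmodMorphism.Build (tensor M N) (tensor M' N') tmap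
    (tlift_is_zmod_morphism tmapDl tmapDr).

Lemma tmap_tens m n : tmap (tens m n) = tens (f m) (g n).
Proof. exact: (tlift_tens tmapDl tmapDr). Qed.

End TensorMap.

Lemma tensor_additive_ext (M N P : zmodType) (f g : {additive tensor M N -> P}) :
  (forall m n, f (tens m n) = g (tens m n)) -> f =1 g.
Proof.
move=> fg; apply: tensor_ind => //.
  by move=> x y; rewrite !raddfD => -> ->.
by move=> x; rewrite !raddfN => ->.
Qed.

(* the product is convolution; the library's product on {ffun A -> R} is
   pointwise *)
Definition grpring (R : comNzRingType) (A : finZmodType) := {ffun A -> R}.

Section GroupRing.
Variables (R : comNzRingType) (A : finZmodType).
Local Notation RA := (grpring R A).
HB.instance Definition _ := GRing.Zmodule.on RA.
Implicit Types x y z : RA.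

(* the element c [g], for g in the additively written group A *)
Definition gsingle (g : A) (c : R) : RA := [ffun h => if h == g then c else 0].

Definition gone : RA := gsingle 0 1.
Definition gmul x y : RA := [ffun k => \sum_(g : A) x g * y (k - g)].

Fact gmulC : commutative gmul.
Proof.
move=> x y; apply/ffunP => k; rewrite !ffunE.
rewrite (reindex_inj (h := fun g => k - g)) /=; last first.
  by move=> g h /addrI /oppr_inj.
by apply: eq_bigr => g _; rewrite mulrC subKr.
Qed.

Fact gmulA : associative gmul.
Proof.
move=> x y z; apply/ffunP => k; rewrite !ffunE.
under eq_bigr do rewrite ffunE mulr_sumr.
under [RHS]eq_bigr do rewrite ffunE mulr_suml.
rewrite [RHS]exchange_big /=; apply: eq_bigr => g _.
rewrite [RHS](reindex_inj (addIr g)) /=; apply: eq_bigr => h _.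
by rewrite mulrA addrK opprD addrA addrAC.
Qed.

Fact gmul1 : left_id gone gmul.
Proof.
move=> x; apply/ffunP => k; rewrite !ffunE (bigD1 0) //= !ffunE eqxx.
by rewrite mul1r subr0 big1 ?addr0 // => g /negPf g0; rewrite ffunE g0 mul0r.
Qed.

Fact gmulDl : left_distributive gmul +%R.
Proof.
move=> x y z; apply/ffunP => k; rewrite !ffunE -big_split /=.
by apply: eq_bigr => g _; rewrite !ffunE mulrDl.
Qed.

Fact gone_neq0 : gone != 0.
Proof.
by apply/eqP => /ffunP/(_ 0)/eqP; rewrite !ffunE eqxx oner_eq0.
Qed.

HB.instance Definition _ := GRing.Zmodule_isComNzRing.Build RA
  gmulA gmulC gmul1 gmulDl gone_neq0.

End GroupRing.

Section GroupRingMap.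
Variables (R : comNzRingType) (A B : finZmodType) (h : {additive A -> B}).

Definition gpush (x : grpring R A) : grpring R B :=
  [ffun k => \sum_(g | h g == k) x g].

Lemma gpush_single g c : gpush (gsingle g c) = gsingle (h g) c.
Proof.
apply/ffunP => k; rewrite !ffunE (eq_sym k) big_mkcond /= (bigD1 g) //=.
rewrite ffunE eqxx big1 ?addr0 // => g' /negPf g'g.
by rewrite ffunE g'g if_same.
Qed.

Fact gpush_is_zmod_morphism : zmod_morphism gpush.
Proof.
move=> x y; apply/ffunP => k; rewrite !ffunE -sumrB.
by apply: eq_bigr => g _; rewrite !ffunE.
Qed.
HB.instance Definition _ := GRing.isZmodMorphism.Build
  (grpring R A) (grpring R B) gpush gpush_is_zmod_morphism.

Fact gpush_is_monoid_morphism : monoid_morphism gpush.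
Proof.
split; first by rewrite /GRing.one /= /gone gpush_single raddf0.
move=> x y; apply/ffunP => k; rewrite !ffunE.
under eq_bigr do rewrite ffunE.
rewrite exchange_big /= (partition_big h predT) //=; apply: eq_bigr => l _.
rewrite ffunE mulr_suml; apply: eq_bigr => g /eqP <-.
rewrite ffunE mulr_sumr (reindex_inj (addIr g)) /=.
apply: eq_big => [g'|g' _]; last by rewrite addrK.
by rewrite raddfD eq_sym -subr_eq eq_sym.
Qed.
HB.instance Definition _ := GRing.isMonoidMorphism.Build
  (grpring R A) (grpring R B) gpush gpush_is_monoid_morphism.
End GroupRingMap.

Record actmod (A : finZmodType) := ActMod {
  actmod_sort :> zmodType;
  act : A -> {additive actmod_sort -> actmod_sort};
  act0 : forall m, act 0 m = m;
  actD : forall g h m, act (g + h) m = act g (act h m)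
}.

(* M (x) R, where a group ring element sum_g c_g [g] sends m (x) r to
   sum_g (g m) (x) (c_g r) *)
Definition scext (R : comNzRingType) (A : finZmodType) (M : actmod A) :=
  tensor M R.

Section ScExt.
Variables (R : comNzRingType) (A : finZmodType) (M : actmod A).
Local Notation T := (scext R M).
HB.instance Definition _ := GRing.Zmodule.on T.

Definition scext_scale (c : grpring R A) (t : T) : T :=
  \sum_(g : A) tmap (act M g) (c g \*o idfun) t.

Lemma scext_scale_tens c m r :
  scext_scale c (tens m r) = \sum_(g : A) tens (act M g m) (c g * r).
Proof. by apply: eq_bigr => g _; rewrite tmap_tens. Qed.

Fact scext_scaleDr : right_distributive scext_scale +%R.
Proof.
by move=> c x y; rewrite -big_split /=; apply: eq_bigr => g _; rewrite raddfD.
Qed.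

Let scaleN c x : scext_scale c (- x) = - scext_scale c x.
Proof. by rewrite -sumrN; apply: eq_bigr => g _; rewrite raddfN. Qed.

Let scale0 c : scext_scale c 0 = 0.
Proof. by apply: big1 => g _; rewrite raddf0. Qed.

Fact scext_scaleDl x : {morph scext_scale^~ x : c d / c + d}.
Proof.
move=> c d; elim/(@tensor_ind M R): x => [x y|x|m r].
- by rewrite !scext_scaleDr => -> ->; rewrite addrACA.
- by rewrite !scaleN => ->; rewrite opprD.
rewrite !scext_scale_tens -big_split /=; apply: eq_bigr => g _.
by rewrite ffunE mulrDl tensDr.
Qed.

Fact scext_scale1 : left_id 1 scext_scale.
Proof.
move=> x; elim/(@tensor_ind M R): x => [x y|x|m r].
- by rewrite !scext_scaleDr => -> ->.
- by rewrite !scaleN => ->.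
rewrite !scext_scale_tens (bigD1 0) //= ffunE eqxx act0 mul1r big1 ?addr0 //.
by move=> g /negPf g0; rewrite ffunE g0 mul0r tensr0.
Qed.

Fact scext_scaleA c d x :
  scext_scale c (scext_scale d x) = scext_scale (c * d) x.
Proof.
elim/(@tensor_ind M R): x => [x y|x|m r].
- by rewrite !scext_scaleDr => -> ->.
- by rewrite !scaleN => ->.
rewrite !scext_scale_tens.
under [RHS]eq_bigr do rewrite ffunE mulr_suml tens_sumr.
rewrite (big_morph (scext_scale c) (scext_scaleDr c) (scale0 c)).
under eq_bigr do rewrite scext_scale_tens.
rewrite exchange_big [RHS]exchange_big /=; apply: eq_bigr => g _.
rewrite [RHS](reindex_inj (addIr g)) /=; apply: eq_bigr => h _.
by rewrite addrK addrC actD mulrA.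
Qed.

HB.instance Definition _ := GRing.Zmodule_isLmodule.Build (grpring R A) T
  scext_scaleA scext_scale1 scext_scaleDr scext_scaleDl.

End ScExt.

Section ScExtMap.
Variables (R : comNzRingType) (A B : finZmodType) (h : {additive A -> B}).
Variables (M : actmod A) (N : actmod B) (f : {additive M -> N}).
Hypothesis fh : forall g m, f (act M g m) = act N (h g) (f m).

Definition scext_map : scext R M -> scext R N := tmap f idfun.
HB.instance Definition _ := GRing.Additive.on scext_map.

Lemma scext_mapZ c x : scext_map (c *: x) = gpush h c *: scext_map x.
Proof.
elim/(@tensor_ind M R): x => [x y|x|m r].
- by rewrite !raddfD /= => -> ->.
- by rewrite !raddfN /= => ->.
rewrite /scext_map [in RHS]tmap_tens /= /GRing.scale /= !scext_scale_tens.
rewrite raddf_sum /= (partition_big h predT) //=; apply: eq_bigr => k _.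
rewrite ffunE mulr_suml tens_sumr; apply: eq_bigr => g /eqP <-.
by rewrite tmap_tens /= fh.
Qed.

End ScExtMap.

Record ringsys := RingSys {
  ringsys_ob :> nat -> comNzRingType;
  ringsys_tr : forall n, {rmorphism ringsys_ob n.+1 -> ringsys_ob n}
}.

Record ringlim (S : ringsys) := RingLim {
  ringlim_val :> forall n, S n;
  ringlimP : forall n, ringsys_tr S n (ringlim_val n.+1) = ringlim_val n
}.

Section RingLimTheory.
Variable S : ringsys.
HB.instance Definition _ := gen_eqMixin (ringlim S).
HB.instance Definition _ := gen_choiceMixin (ringlim S).

Lemma ringlim_ext (x y : ringlim S) : (forall n, x n = y n) -> x = y.
Proof.
case: x y => [x xP] [y yP] /= exy.
have e : x = y by apply: functional_extensionality_dep.
by move: xP yP; rewrite e => xP yP; congr RingLim; apply: Prop_irrelevance.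
Qed.

Fact ringlim0P n :
  ringsys_tr S n (0) = 0.
Proof. by rewrite raddf0. Qed.
Definition ringlim0 :=
  @RingLim S (fun n => 0) ringlim0P.
Fact ringlim1P n :
  ringsys_tr S n (1) = 1.
Proof. by rewrite rmorph1. Qed.
Definition ringlim1 :=
  @RingLim S (fun n => 1) ringlim1P.
Fact ringlim_oppP (x : ringlim S) n :
  ringsys_tr S n (- x n.+1) = - x n.
Proof. by rewrite rmorphN ringlimP. Qed.
Definition ringlim_opp (x : ringlim S) :=
  @RingLim S (fun n => - x n) (ringlim_oppP x).
Fact ringlim_addP (x y : ringlim S) n :
  ringsys_tr S n (x n.+1 + y n.+1) = x n + y n.
Proof. by rewrite rmorphD !ringlimP. Qed.
Definition ringlim_add (x y : ringlim S) :=
  @RingLim S (fun n => x n + y n) (ringlim_addP x y).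
Fact ringlim_mulP (x y : ringlim S) n :
  ringsys_tr S n (x n.+1 * y n.+1) = x n * y n.
Proof. by rewrite rmorphM !ringlimP. Qed.
Definition ringlim_mul (x y : ringlim S) :=
  @RingLim S (fun n => x n * y n) (ringlim_mulP x y).

Fact ringlim_addA : associative ringlim_add.
Proof. by move=> x y z; apply: ringlim_ext => n; rewrite /= addrA. Qed.
Fact ringlim_addC : commutative ringlim_add.
Proof. by move=> x y; apply: ringlim_ext => n; rewrite /= addrC. Qed.
Fact ringlim_add0 : left_id ringlim0 ringlim_add.
Proof. by move=> x; apply: ringlim_ext => n; rewrite /= add0r. Qed.
Fact ringlim_addN : left_inverse ringlim0 ringlim_opp ringlim_add.
Proof. by move=> x; apply: ringlim_ext => n; rewrite /= addNr. Qed.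
HB.instance Definition _ := GRing.isZmodule.Build (ringlim S)
  ringlim_addA ringlim_addC ringlim_add0 ringlim_addN.

Fact ringlim_mulA : associative ringlim_mul.
Proof. by move=> x y z; apply: ringlim_ext => n; rewrite /= mulrA. Qed.
Fact ringlim_mulC : commutative ringlim_mul.
Proof. by move=> x y; apply: ringlim_ext => n; rewrite /= mulrC. Qed.
Fact ringlim_mul1 : left_id ringlim1 ringlim_mul.
Proof. by move=> x; apply: ringlim_ext => n; rewrite /= mul1r. Qed.
Fact ringlim_mulDl : left_distributive ringlim_mul +%R.
Proof. by move=> x y z; apply: ringlim_ext => n; rewrite /= mulrDl. Qed.
Fact ringlim_1neq0 : ringlim1 != 0.
Proof.
apply/eqP => /(congr1 (fun x : ringlim S => x 0%N))/eqP.
by rewrite /= oner_eq0.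
Qed.
HB.instance Definition _ := GRing.Zmodule_isComNzRing.Build (ringlim S)
  ringlim_mulA ringlim_mulC ringlim_mul1 ringlim_mulDl ringlim_1neq0.
End RingLimTheory.

Record modsys (S : ringsys) := ModSys {
  modsys_ob :> forall n, lmodType (S n);
  modsys_tr : forall n, {additive modsys_ob n.+1 -> modsys_ob n};
  modsys_trZ : forall n (c : S n.+1) (x : modsys_ob n.+1),
    modsys_tr n (c *: x) = ringsys_tr S n c *: modsys_tr n x
}.

Record modlim (S : ringsys) (M : modsys S) := ModLim {
  modlim_val :> forall n, M n;
  modlimP : forall n, modsys_tr M n (modlim_val n.+1) = modlim_val n
}.

Section ModLimTheory.
Variables (S : ringsys) (M : modsys S).
HB.instance Definition _ := gen_eqMixin (modlim M).
HB.instance Definition _ := gen_choiceMixin (modlim M).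

Lemma modlim_ext (x y : modlim M) : (forall n, x n = y n) -> x = y.
Proof.
case: x y => [x xP] [y yP] /= exy.
have e : x = y by apply: functional_extensionality_dep.
by move: xP yP; rewrite e => xP yP; congr ModLim; apply: Prop_irrelevance.
Qed.

Fact modlim0P n :
  modsys_tr M n (0) = 0.
Proof. by rewrite raddf0. Qed.
Definition modlim0 :=
  @ModLim S M (fun n => 0) modlim0P.
Fact modlim_oppP (x : modlim M) n :
  modsys_tr M n (- x n.+1) = - x n.
Proof. by rewrite raddfN modlimP. Qed.
Definition modlim_opp (x : modlim M) :=
  @ModLim S M (fun n => - x n) (modlim_oppP x).
Fact modlim_addP (x y : modlim M) n :
  modsys_tr M n (x n.+1 + y n.+1) = x n + y n.
Proof. by rewrite raddfD !modlimP. Qed.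
Definition modlim_add (x y : modlim M) :=
  @ModLim S M (fun n => x n + y n) (modlim_addP x y).
Fact modlim_scaleP (c : ringlim S) (x : modlim M) n :
  modsys_tr M n (c n.+1 *: x n.+1) = c n *: x n.
Proof. by rewrite modsys_trZ ringlimP modlimP. Qed.
Definition modlim_scale (c : ringlim S) (x : modlim M) :=
  @ModLim S M (fun n => c n *: x n) (modlim_scaleP c x).

Fact modlim_addA : associative modlim_add.
Proof. by move=> x y z; apply: modlim_ext => n; rewrite /= addrA. Qed.
Fact modlim_addC : commutative modlim_add.
Proof. by move=> x y; apply: modlim_ext => n; rewrite /= addrC. Qed.
Fact modlim_add0 : left_id modlim0 modlim_add.
Proof. by move=> x; apply: modlim_ext => n; rewrite /= add0r. Qed.
Fact modlim_addN : left_inverse modlim0 modlim_opp modlim_add.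
Proof. by move=> x; apply: modlim_ext => n; rewrite /= addNr. Qed.
HB.instance Definition _ := GRing.isZmodule.Build (modlim M)
  modlim_addA modlim_addC modlim_add0 modlim_addN.

Fact modlim_scaleA c d x :
  modlim_scale c (modlim_scale d x) = modlim_scale (c * d) x.
Proof. by apply: modlim_ext => n; rewrite /= scalerA. Qed.
Fact modlim_scale1 : left_id 1 modlim_scale.
Proof. by move=> x; apply: modlim_ext => n; rewrite /= scale1r. Qed.
Fact modlim_scaleDr : right_distributive modlim_scale +%R.
Proof. by move=> c x y; apply: modlim_ext => n; rewrite /= scalerDr. Qed.
Fact modlim_scaleDl x : {morph modlim_scale^~ x : c d / c + d}.
Proof. by move=> c d; apply: modlim_ext => n; rewrite /= scalerDl. Qed.
HB.instance Definition _ := GRing.Zmodule_isLmodule.Build (ringlim S) (modlim M)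
  modlim_scaleA modlim_scale1 modlim_scaleDr modlim_scaleDl.
End ModLimTheory.

Section Iwasawa.
Variable q : nat.

(* Z/q^(n+1) rather than Z/q^n, since 'Z_1 would be Z/2 *)
Definition zmod_red (n : nat) (x : 'Z_(q ^ n.+2)) : 'Z_(q ^ n.+1) := inZp x.

Let zmod_dvd n : ((Zp_trunc (q ^ n.+1)).+2 %| (Zp_trunc (q ^ n.+2)).+2)%N.
Proof.
case: q => [|[|k]]; rewrite ?exp0n ?exp1n //.
by rewrite !Zp_cast ?dvdn_exp2l // expnS (leq_trans _ (leq_pmulr _ _)) ?expn_gt0.
Qed.

Fact zmod_red_is_nmod_morphism n : nmod_morphism (@zmod_red n).
Proof.
split=> [|x y]; apply: val_inj; first by rewrite /= mod0n.
by rewrite /= modn_dvdm // modnDm.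
Qed.

Fact zmod_red_is_monoid_morphism n : monoid_morphism (@zmod_red n).
Proof.
split=> [|x y]; apply: val_inj; first by rewrite /= !modn_small.
by rewrite /= modn_dvdm // modnMm.
Qed.

HB.instance Definition _ n := GRing.isNmodMorphism.Build _ _ (@zmod_red n)
  (zmod_red_is_nmod_morphism n).
HB.instance Definition _ n := GRing.isMonoidMorphism.Build _ _ (@zmod_red n)
  (zmod_red_is_monoid_morphism n).

Definition Zq_sys : ringsys :=
  @RingSys (fun n => 'Z_(q ^ n.+1)) (fun n => @zmod_red n).

Definition Zq : comNzRingType := ringlim Zq_sys.

Let Gam_dvd m : ((q ^ m).-1.+1 %| (q ^ m.+1).-1.+1)%N.
Proof.
have [->|q0] := posnP q; first by case: m => [|m]; rewrite ?expn0 ?exp0n.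
by rewrite !prednK ?expn_gt0 ?q0 // dvdn_exp2l.
Qed.

Fact Gam_proj_is_nmod_morphism m : nmod_morphism (@Gam_proj q m).
Proof.
split=> [|x y]; apply: val_inj; first by rewrite /= mod0n.
by rewrite /= modn_dvdm ?Gam_dvd // modnDm.
Qed.
HB.instance Definition _ m := GRing.isNmodMorphism.Build
  (Gam q m.+1) (Gam q m) (@Gam_proj q m) (Gam_proj_is_nmod_morphism m).

Lemma Gam_proj_theta m : Gam_proj (theta_ q m.+1) = theta_ q m.
Proof. by apply: val_inj; rewrite /= modn_dvdm // Gam_dvd. Qed.

Definition Lambda_sys : ringsys :=
  @RingSys (fun m => grpring Zq (Gam q m)) (fun m => gpush (@Gam_proj q m)).

(* Z_q[[Gamma]], as the inverse limit of the Z_q[Gamma / Gamma^(q^m)] *)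
Definition Lambda : comNzRingType := ringlim Lambda_sys.

Fact Lambda_constP (c : Zq) m :
  ringsys_tr Lambda_sys m (gsingle 0 c) = gsingle 0 c.
Proof. by rewrite /= gpush_single raddf0. Qed.
Definition Lambda_const (c : Zq) : Lambda :=
  @RingLim Lambda_sys (fun m => gsingle 0 c) (Lambda_constP c).

Fact thetaP m : ringsys_tr Lambda_sys m (gsingle (theta_ q m.+1) 1) =
  gsingle (theta_ q m) 1.
Proof. by rewrite /= gpush_single /= Gam_proj_theta. Qed.
Definition theta : Lambda :=
  @RingLim Lambda_sys (fun m => gsingle (theta_ q m) 1) thetaP.

(* T = theta - 1 under Z_q[[Gamma]] = Z_q[[T]] *)
Definition at_T (f : {poly Zq}) : Lambda :=
  (map_poly Lambda_const f).[theta - 1].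

Variable X : digraph.

Definition transl m (g : Gam q m) : bfhom (layer X q m) (layer X q m) :=
  @derived_map X _ _ _ _ (+%R g) (fun h => addrA g h (theta_ q m)).

Fact bf_act0 m x : bfmap (@transl m 0) x = x.
Proof. by apply: bfmap_id => -[v k]; rewrite /= /derived_fun /= add0r. Qed.

Fact bf_actD m (g h : Gam q m) x :
  bfmap (transl (g + h)) x = bfmap (transl g) (bfmap (transl h) x).
Proof.
by apply/esym/bfmap_comp => -[v k]; rewrite /= /derived_fun /= addrA.
Qed.

Definition bf_layer m : actmod (Gam q m) :=
  @ActMod _ (BF (layer X q m)) (fun g => bfmap (transl g))
    (@bf_act0 m) (@bf_actD m).

Fact Gam_projD_theta m (g : Gam q m.+1) :
  Gam_proj (g + theta_ q m.+1) = Gam_proj g + theta_ q m.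
Proof. by rewrite raddfD /= Gam_proj_theta. Qed.

Definition layer_proj m : bfhom (layer X q m.+1) (layer X q m) :=
  derived_map X (@Gam_projD_theta m).

Fact layer_projP m (g : Gam q m.+1) x :
  bfmap (layer_proj m) (act (bf_layer m.+1) g x) =
  act (bf_layer m) (Gam_proj g) (bfmap (layer_proj m) x).
Proof.
pose f := derived_map X (h := fun k => Gam_proj g + Gam_proj k) (fun k =>
  etrans (congr1 _ (Gam_projD_theta k)) (addrA _ _ _)).
rewrite /= (@bfmap_comp _ _ _ _ _ f) => [|[v k]].
  by rewrite (@bfmap_comp _ _ _ _ _ f).
by rewrite /= /derived_fun /= raddfD.
Qed.

Definition BF_sys : modsys Lambda_sys :=
  @ModSys Lambda_sys (fun m => scext Zq (bf_layer m))
    (fun m => @scext_map Zq _ _ (bf_layer m.+1) (bf_layer m)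
                               (bfmap (layer_proj m)))
    (fun m => @scext_mapZ Zq _ _ (@Gam_proj q m) (bf_layer m.+1) (bf_layer m)
                (bfmap (layer_proj m)) (@layer_projP m)).

Definition BF_inf : lmodType Lambda := modlim BF_sys.

End Iwasawa.

Section CyclicModule.
Variables (R : comNzRingType) (d : R).

Definition princ : {pred R} := fun x => `[< exists c, x = c * d >].

Fact princ_closed : zmod_closed princ.
Proof.
split; first by apply/asboolP; exists 0; rewrite mul0r.
move=> _ _ /asboolP[a ->] /asboolP[b ->]; apply/asboolP; exists (a - b).
by rewrite mulrBl.
Qed.
HB.instance Definition _ := GRing.isZmodClosed.Build R princ princ_closed.

Definition cyc := Quotient.quot princ.
HB.instance Definition _ := GRing.Zmodule.on cyc.
HB.instance Definition _ :
    ZmodQuotient _ (Quotient.equiv princ) 0 -%R +%R cyc :=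
  ZmodQuotient.on cyc.

Definition cyc_scale (a : R) (x : cyc) : cyc :=
  \pi_cyc (a * generic_quotient.repr x).

Lemma cyc_scale_pi a x : cyc_scale a (\pi_cyc x) = \pi_cyc (a * x).
Proof.
apply/eqP; rewrite -Quotient.idealrBE -mulrBr.
have /asboolP[c e] : princ (generic_quotient.repr (\pi_cyc x) - x).
  by rewrite -[princ _]/(_ \in princ) Quotient.idealrBE reprK.
by rewrite e; apply/asboolP; exists (a * c); rewrite mulrA.
Qed.

Fact cyc_scaleA a b x : cyc_scale a (cyc_scale b x) = cyc_scale (a * b) x.
Proof. by elim/quotW: x => x; rewrite (cyc_scale_pi b) !cyc_scale_pi mulrA. Qed.
Fact cyc_scale1 : left_id 1 cyc_scale.
Proof. by move=> x; elim/quotW: x => x; rewrite cyc_scale_pi mul1r. Qed.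
Fact cyc_scaleDr : right_distributive cyc_scale +%R.
Proof.
move=> a x y; elim/quotW: x => x; elim/quotW: y => y.
by rewrite -raddfD !cyc_scale_pi mulrDr raddfD.
Qed.
Fact cyc_scaleDl x : {morph cyc_scale^~ x : a b / a + b}.
Proof.
by move=> a b; elim/quotW: x => x; rewrite !cyc_scale_pi mulrDl raddfD.
Qed.
HB.instance Definition _ := GRing.Zmodule_isLmodule.Build R cyc
  cyc_scaleA cyc_scale1 cyc_scaleDr cyc_scaleDl.
End CyclicModule.

(* 'rV[R]_0 is the zero module *)
Fixpoint cyc_sum (R : comNzRingType) (ds : seq R) : lmodType R :=
  if ds is d :: ds' then (cyc d * cyc_sum ds')%type else 'rV[R]_0.

Section Cokernel.
Variables (M N : zmodType) (f : {additive M -> N}).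

Definition im_pred : {pred N} := fun y => `[< exists x, y = f x >].

Fact im_pred_closed : zmod_closed im_pred.
Proof.
split; first by apply/asboolP; exists 0; rewrite raddf0.
move=> _ _ /asboolP[a ->] /asboolP[b ->]; apply/asboolP; exists (a - b).
by rewrite raddfB.
Qed.
HB.instance Definition _ := GRing.isZmodClosed.Build N im_pred im_pred_closed.

Definition coker := Quotient.quot im_pred.
End Cokernel.

Definition fin_gen (R : pzRingType) (M : lmodType R) : Prop :=
  exists (n : nat) (s : 'I_n -> M),
    forall x, exists c : 'I_n -> R, x = \sum_i c i *: s i.

(* R is meant to be an integral domain *)
Definition torsion (R : pzRingType) (M : lmodType R) : Prop :=
  forall x : M, exists2 c : R, c != 0 & c *: x = 0.

Definition pseudo_iso (R : pzRingType) (M N : lmodType R)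
    (f : {linear M -> N}) : Prop :=
  finite_set [set x | f x = 0]%classic /\ finite_set [set: coker f]%classic.

Definition distinguished (q : nat) (f : {poly Zq q}) : Prop :=
  f \is monic /\
  forall i, (i < (size f).-1)%N -> exists c : Zq q, f`_i = q%:R * c.

(* mu and lambda are the Iwasawa invariants of the finitely generated torsion
   Lambda-module M, read off an elementary module pseudo-isomorphic to M *)
Definition iwasawa_invariants (q : nat) (M : lmodType (Lambda q))
    (mu lambda : nat) : Prop :=
  [/\ fin_gen M, torsion M &
    exists (ms : seq nat) (fs : seq {poly Zq q})
      (phi : {linear M -> cyc_sum ([seq q%:R ^+ m | m <- ms] ++
                                   [seq at_T f | f <- fs])}),
    [/\ {in ms, forall m, (0 < m)%N},
        {in fs, forall f, distinguished f},
        pseudo_iso phi,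
        mu = sumn ms &
        lambda = sumn [seq (size f).-1 | f : {poly Zq q} <- fs]]].

(* Main.v *)
From HB Require Import structures.
Require Import Defs.
From mathcomp Require Import all_boot all_order all_fingroup all_algebra.
From mathcomp Require Import algC cyclotomic finfield generic_quotient.
From mathcomp Require Import boolp classical_sets cardinality ring.

Set Implicit Arguments.
Unset Strict Implicit.
Unset Printing Implicit Defensive.

Import GRing.Theory.
Local Open Scope ring_scope.

(** Why the statement holds.  Put n = p - 1, let u be the inverse of theta, and
    let S be left multiplication by sigma.

    Bowen-Franks module.  At every level, BF(X_m) tensored with Z_q is the module
    over Z_q[Gamma_m] with one generator w_g for each g in G and one relation
    w_g = theta (w_(g sigma) + w_(g tau)) for each g.  The ring Lambda is compact,
    so this presentation passes to the inverse limit ([bfgen_rel],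
    [bfgen_span], [bfgen_kernel]).  Since tau^j sigma = sigma^(a^j) tau^j, the
    relations say that w_(tau^(j+1)) = (u - S^(a^j)) w_(tau^j).  The module is
    therefore cyclic over Lambda[C_p], where C_p is generated by sigma, and the
    equality tau^n = 1 leaves the single relation N = 1, where N is the product
    of the u - S^k over the nonzero residues k.  The element N is fixed by the
    automorphisms of C_p, so N = alpha + beta nu with nu the sum of the S^k.
    Sending S to a primitive p-th root of unity gives
    alpha = 1 + u + ... + u^(p-1), and sending S to 1 gives
    alpha + p beta = (u - 1)^n ([gnormE], [gnorm_aug]).  With h = alpha - 1 the
    relation N = 1 reads h S^k + beta nu = 0 for all k.  Hence h kills the
    differences z_k = w_(sigma^k) - w_1, and
    ((u - 1)^n - 1) w_1 = - beta (the sum of the z_k), where (u - 1)^n - 1 is a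
    unit because u - 1 is topologically nilpotent.  So the limit is the direct
    sum of n copies of Lambda/(h), with basis the z_k ([zgen_span],
    [zgen_kernelP]).  Finally h = u (u^n - 1)/(u - 1) is a unit times
    f(T) = ((1 + T)^Q - 1)/T with Q = q^val_q(n) ([annih_assoc]), and f is a
    distinguished polynomial of degree Q - 1.  The pseudo-isomorphism is thus an
    isomorphism onto n copies of Lambda/(f), which gives mu = 0 and
    lambda = n (Q - 1), a number that vanishes when q does not divide n.

    Defect.  The adjacency matrix of X_m is (s + t) th, where s, t and th are the
    permutation matrices of sigma, tau and theta.  After projection to an
    eigenspace of s the same walk along the powers of tau becomes an identity
    between polynomials in x = s + t alone: (x - 1)^n = 1 on the eigenspace of 1
    and 1 + x + ... + x^(p-1) = 1 on the others.  Both equations have simple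
    roots, so x is diagonalizable ([metacyclic_diagonalizable]); so is th, which
    has finite order and commutes with x.  Hence the product is diagonalizable,
    and the two multiplicities of each of its eigenvalues agree. *)

(** * Group rings *)

Section GroupRingMaps.
Variables (R : comNzRingType) (A : finZmodType).

Lemma gsingleM (g h : A) (x y : R) :
  gsingle g x * gsingle h y = gsingle (g + h) (x * y) :> grpring R A.
Proof.
apply/ffunP => k; rewrite [LHS]ffunE (bigD1 g) //= !ffunE eqxx big1 ?addr0.
  by rewrite subr_eq addrC; case: ifP => _; rewrite ?mulr0.
by move=> l /negPf lg; rewrite ffunE lg mul0r.
Qed.

Lemma gsingle1 : gsingle 0 1 = 1 :> grpring R A. Proof. by []. Qed.

Lemma gsingle_exp (g : A) (x : R) i :
  gsingle g x ^+ i = gsingle (g *+ i) (x ^+ i) :> grpring R A.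
Proof. by elim: i => [|i IH] //; rewrite !exprS IH gsingleM mulrS. Qed.

Lemma grpring_sumE (x : grpring R A) : x = \sum_g gsingle g (x g).
Proof.
apply/ffunP => k; rewrite sum_ffunE (bigD1 k) //= ffunE eqxx big1 ?addr0 //.
by move=> g /negPf gk; rewrite ffunE eq_sym gk.
Qed.

Lemma gsingle0M (c : R) (x : grpring R A) k : (gsingle 0 c * x) k = c * x k.
Proof.
rewrite ffunE (bigD1 0) //= ffunE eqxx subr0 big1 ?addr0 // => g /negPf g0.
by rewrite ffunE g0 mul0r.
Qed.

Lemma gsingle_shift (h : A) (x : grpring R A) g : (gsingle h 1 * x) g = x (g - h).
Proof.
rewrite ffunE (bigD1 h) //= ffunE eqxx mul1r big1 ?addr0 // => k /negPf kh.
by rewrite ffunE kh mul0r.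
Qed.

Fact gsingle0_is_zmod_morphism : zmod_morphism (gsingle 0 : R -> grpring R A).
Proof. by move=> x y; apply/ffunP => k; rewrite !ffunE; case: ifP; rewrite ?subr0. Qed.
Fact gsingle0_is_monoid_morphism : monoid_morphism (gsingle 0 : R -> grpring R A).
Proof. by split=> // x y; rewrite gsingleM addr0. Qed.
HB.instance Definition _ := GRing.isZmodMorphism.Build R (grpring R A) (gsingle 0)
  gsingle0_is_zmod_morphism.
HB.instance Definition _ := GRing.isMonoidMorphism.Build R (grpring R A) (gsingle 0)
  gsingle0_is_monoid_morphism.

Section Coefficients.
Variables (R' : comNzRingType) (f : {rmorphism R -> R'}).

Definition gmap (x : grpring R A) : grpring R' A := [ffun g => f (x g)].

Fact gmap_is_zmod_morphism : zmod_morphism gmap.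
Proof. by move=> x y; apply/ffunP => k; rewrite !ffunE rmorphB. Qed.
HB.instance Definition _ := GRing.isZmodMorphism.Build _ _ gmap
  gmap_is_zmod_morphism.

Lemma gmap_single g c : gmap (gsingle g c) = gsingle g (f c).
Proof. by apply/ffunP => k; rewrite !ffunE; case: ifP; rewrite ?rmorph0. Qed.

Fact gmap_is_monoid_morphism : monoid_morphism gmap.
Proof.
split; first by rewrite -gsingle1 gmap_single rmorph1.
move=> x y; apply/ffunP => k; rewrite !ffunE rmorph_sum; apply: eq_bigr => g _.
by rewrite !ffunE rmorphM.
Qed.
HB.instance Definition _ := GRing.isMonoidMorphism.Build _ _ gmap
  gmap_is_monoid_morphism.
End Coefficients.
End GroupRingMaps.

(** Together with a map on coefficients, a character evaluates the elements of
    a group ring in a commutative ring. *)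
Record gchar (A : finZmodType) (B : comNzRingType) := GChar {
  gchar_fun :> A -> B;
  gchar0 : gchar_fun 0 = 1;
  gcharD : forall g h, gchar_fun (g + h) = gchar_fun g * gchar_fun h
}.

Section GroupRingEval.
Variables (R B : comNzRingType) (A : finZmodType).
Variables (f : {rmorphism R -> B}) (chi : gchar A B).

Definition geval (x : grpring R A) : B := \sum_g f (x g) * chi g.

Fact geval_is_zmod_morphism : zmod_morphism geval.
Proof.
move=> x y; rewrite /geval -sumrB; apply: eq_bigr => g _.
by rewrite !ffunE rmorphB mulrBl.
Qed.
HB.instance Definition _ := GRing.isZmodMorphism.Build _ _ geval
  geval_is_zmod_morphism.

Lemma geval_single g c : geval (gsingle g c) = f c * chi g.
Proof.
rewrite /geval (bigD1 g) //= ffunE eqxx big1 ?addr0 // => h /negPf hg.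
by rewrite ffunE hg rmorph0 mul0r.
Qed.

Fact geval_is_monoid_morphism : monoid_morphism geval.
Proof.
split; first by rewrite -gsingle1 geval_single rmorph1 gchar0 mulr1.
move=> x y; rewrite /geval mulr_suml.
under eq_bigr => k _ do rewrite ffunE rmorph_sum mulr_suml.
rewrite exchange_big; apply: eq_bigr => g _; rewrite mulr_sumr.
rewrite (reindex_inj (addrI g)) /=; apply: eq_bigr => h _.
by rewrite addrAC subrr add0r rmorphM gcharD mulrACA.
Qed.
HB.instance Definition _ := GRing.isMonoidMorphism.Build _ _ geval
  geval_is_monoid_morphism.
End GroupRingEval.

(** * Powers of a primitive root of unity *)

Section PrimitiveRoots.
Variables (R : idomainType) (n : nat) (w : R).
Hypothesis w_prim : n.-primitive_root w.

Lemma prim_root_neq0 : w != 0.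
Proof.
apply/eqP => w0; have := prim_expr_order w_prim.
rewrite w0 expr0n -(prednK (prim_order_gt0 w_prim)) => /eqP.
by rewrite eq_sym oner_eq0.
Qed.

Lemma prim_pow_inj : injective (fun j : 'I_n => w ^+ j).
Proof.
move=> i j /eqP; rewrite (eq_prim_root_expr w_prim) !modn_small // => /eqP.
exact: val_inj.
Qed.

Definition prim_powers : seq R := [seq w ^+ i | i <- index_iota 0 n].

Lemma uniq_prim_powers : uniq prim_powers.
Proof.
rewrite map_inj_in_uniq ?iota_uniq // => i j; rewrite !mem_index_iota /= => ip jp.
by move/eqP; rewrite (eq_prim_root_expr w_prim) !modn_small // => /eqP.
Qed.
End PrimitiveRoots.

Lemma prod_prim_powers (F : fieldType) n (w : F) : n.-primitive_root w ->
  \prod_(y <- prim_powers n w) ('X - y%:P) = 'X^n - 1.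
Proof. by move=> w_prim; rewrite big_map -(factor_Xn_sub_1 w_prim). Qed.

(** * The norm element of the group ring of a cyclic group of prime order *)

Section NormElement.
Variable p : nat.
Hypothesis p_pr : prime p.

Lemma big_Fp (T : Type) (idx : T) (op : T -> T -> T) (F : nat -> T) :
  \big[op/idx]_(k : 'F_p) F k = \big[op/idx]_(i < p) F i.
Proof.
have E n := @big_mkord T idx op n xpredT F.
by rewrite -(E p) -[p in RHS](Fp_cast p_pr) E.
Qed.

Section RootChar.
Variable w : algC.
Hypothesis w_prim : p.-primitive_root w.

Definition rootC_fun (k : 'F_p) : {poly algC} := (w ^+ k)%:P.
Fact rootC_fun0 : rootC_fun 0 = 1. Proof. by rewrite /rootC_fun expr0. Qed.
Fact rootC_funD k l : rootC_fun (k + l) = rootC_fun k * rootC_fun l.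
Proof.
have E (i j : nat) : ((i + j) %% (Zp_trunc (pdiv p)).+2 = (i + j) %% p)%N.
  by rewrite Fp_cast.
by rewrite /rootC_fun -polyCM -exprD /= E (prim_expr_mod w_prim).
Qed.
Definition rootC : gchar 'F_p {poly algC} := GChar rootC_fun0 rootC_funD.
End RootChar.

(** Reading k as an exponent of a generator S of the cyclic group, this is the
    norm, for the action of the automorphisms of the group, of u - S. *)
Definition gnorm (R : comNzRingType) (u : R) : grpring R 'F_p :=
  \prod_(k : 'F_p | k != 0) (gsingle 0 u - gsingle k 1).

Lemma gmap_gnorm (R R' : comNzRingType) (f : {rmorphism R -> R'}) u :
  gmap f (gnorm u) = gnorm (f u).
Proof.
rewrite rmorph_prod; apply: eq_bigr => k _.
by rewrite rmorphB /= !gmap_single rmorph1.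
Qed.

(** The automorphism k of 'F_p permutes the factors of the norm, so it permutes
    the coefficients without changing the norm; these automorphisms are
    transitive on the nonzero residues. *)
Lemma gnorm_const (R : comNzRingType) (u : R) (k : 'F_p) :
  k != 0 -> gnorm u k = gnorm u 1.
Proof.
move=> k0; pose h : {additive 'F_p -> 'F_p} := (k \*o idfun).
have hinj : injective h by move=> x y /(mulfI k0).
have hN : gpush h (gnorm u) = gnorm u.
  rewrite rmorph_prod [RHS](reindex_inj hinj) /=.
  apply: eq_big => [l|l _]; first by rewrite mulf_eq0 (negPf k0).
  by rewrite rmorphB /= !gpush_single /= mulr0.
rewrite -{1}hN ffunE (big_pred1 1) // => l /=.
have h1 : h 1 = k by rewrite /= mulr1.
by apply/eqP/eqP => [e|-> //]; apply: hinj; rewrite h1.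
Qed.

Lemma prod_prim_root (w : algC) : p.-primitive_root w ->
  \prod_(k : 'F_p | k != 0) ('X - (w ^+ k)%:P) = \sum_(i < p) 'X^i.
Proof.
move=> w_prim.
have X1 : 'X - 1 != 0 :> {poly algC} by rewrite -polyC1 polyXsubC_eq0.
apply: (mulfI X1); rewrite -subrX1 -(factor_Xn_sub_1 w_prim) big_mkord.
transitivity (\prod_(k : 'F_p) ('X - (w ^+ k)%:P)).
  by rewrite [RHS](bigD1 0) //= expr0.
exact: (big_Fp _ _ (fun i => 'X - (w ^+ i)%:P)).
Qed.

Let Phi : {poly int} := \sum_(i < p) 'X^i.

(** For the generic u the coefficients are integral polynomials, which can be
    compared after evaluating the group element at a primitive p-th root of
    unity: there the sum of all group elements vanishes and the norm becomes
    the p-th cyclotomic polynomial. *)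
Lemma gnorm_generic : gnorm ('X : {poly int}) 0 = Phi + gnorm 'X 1.
Proof.
have [w w_prim] := C_prim_root_exists (prime_gt0 p_pr).
pose f : {rmorphism {poly int} -> {poly algC}} := map_poly intr.
have finj : injective f by apply: map_inj_poly => // x y /intr_inj.
apply: finj; apply/eqP; rewrite rmorphD -subr_eq -rmorphB; apply/eqP.
(* All coefficients but the one at 0 agree, so evaluation at the root only sees
   the difference of the two distinct values. *)
have e1 : geval f (rootC w_prim) (gnorm 'X) =
    f (gnorm 'X 0 - gnorm 'X 1).
  rewrite /geval (eq_bigr (fun k => f (gnorm 'X 1) * rootC w_prim k +
    (if k == 0 then f (gnorm 'X 0 - gnorm 'X 1) else 0))); last first.
    move=> k _; case: eqVneq => [->|k0]; last by rewrite addr0 gnorm_const.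
    by rewrite gchar0 !mulr1 -rmorphD addrC subrK.
  rewrite big_split /= -mulr_sumr -big_mkcond /= big_pred1_eq.
  rewrite (big_Fp _ _ (fun i => (w ^+ i)%:P)) -rmorph_sum /=.
  suff -> : \sum_(i < p) w ^+ i = 0 by rewrite mulr0 add0r.
  have w1 : w - 1 != 0.
    rewrite subr_eq0; apply: contraTneq (prime_gt1 p_pr) => w1.
    by have := prim_order_dvd w_prim 1; rewrite w1 expr1n eqxx dvdn1 => /eqP ->.
  by apply: (mulfI w1); rewrite -subrX1 prim_expr_order // subrr mulr0.
rewrite -e1 rmorph_prod /= rmorph_sum /=.
under [in RHS]eq_bigr => i _ do rewrite map_polyXn.
rewrite -(prod_prim_root w_prim); apply: eq_bigr => k _.
rewrite rmorphB /= !geval_single /= map_polyX /= rmorph1 mul1r.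
by rewrite [rootC_fun _ 0]rootC_fun0 mulr1.
Qed.

(** Every instance is obtained from the generic one by evaluating the integral
    polynomials at u. *)
Lemma gnormE (R : comNzRingType) (u : R) :
  gnorm u = gsingle 0 (\sum_(i < p) u ^+ i) + [ffun => gnorm u 1].
Proof.
apply/ffunP => k; rewrite !ffunE.
case: eqVneq => [->|/gnorm_const ->]; last by rewrite add0r.
pose f : {rmorphism {poly int} -> R} := horner_eval u \o map_poly intr.
have fX : f 'X = u by rewrite /= map_polyX /horner_eval hornerX.
rewrite -fX -gmap_gnorm !ffunE gnorm_generic rmorphD rmorph_sum.
by under eq_bigr => i _ do rewrite rmorphXn.
Qed.

Fact one_gchar_proof (B : comNzRingType) : 1 = 1 * 1 :> B.
Proof. by rewrite mulr1. Qed.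
Definition triv_gchar (A : finZmodType) (B : comNzRingType) : gchar A B :=
  @GChar A B (fun=> 1) erefl (fun _ _ => one_gchar_proof B).

(** The augmentation sends each of the p - 1 factors to u - 1. *)
Lemma gnorm_aug (R : comNzRingType) (u : R) :
  \sum_(i < p) u ^+ i + p%:R * gnorm u 1 = (u - 1) ^+ p.-1.
Proof.
pose e : {rmorphism grpring R 'F_p -> R} := geval idfun (triv_gchar 'F_p R).
have eE x : e x = \sum_k x k by apply: eq_bigr => k _; rewrite mulr1.
have cardFp : #|'F_p| = p by rewrite card_Fp.
have <- : e (gnorm u) = (u - 1) ^+ p.-1.
  rewrite rmorph_prod (eq_bigr (fun=> u - 1)) => [|k _]; last first.
    by rewrite rmorphB /= !geval_single /= !mulr1.
  by rewrite prodr_const cardC1 cardFp.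
rewrite [in RHS]gnormE raddfD /= geval_single mulr1; congr (_ + _).
rewrite eE (eq_bigr (fun=> gnorm u 1)) => [|k _]; last by rewrite !ffunE.
by rewrite sumr_const cardFp mulr_natl.
Qed.
End NormElement.

(** * Compactness and units of the Iwasawa algebra *)

Lemma dependent_choice (T : nat -> Type) (P : forall k, T k -> Prop)
    (R : forall k, T k -> T k.+1 -> Prop) :
    (exists x, P 0%N x) ->
    (forall k x, P k x -> exists2 y, P k.+1 y & R k x y) ->
  exists s : forall k, T k, forall k, P k (s k) /\ R k (s k) (s k.+1).
Proof.
move=> /cid[x0 Px0] step.
have next k (x : {x | P k x}) : {y : {y | P k.+1 y} | R k (sval x) (sval y)}.
  by have [y Py Ry] := cid2 (step k _ (svalP x)); exists (exist _ y Py).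
pose s := nat_rect (fun k => {x | P k x}) (exist _ x0 Px0)
  (fun k x => sval (next k x)).
by exists (fun k => sval (s k)) => k; split; [apply: svalP | apply: (svalP (next k _))].
Qed.

Section Konig.
Variables (T : nat -> finType) (f : forall k, T k.+1 -> T k).
Variable (P : forall k, T k -> Prop).
Hypotheses (exP : forall k, exists x : T k, P x)
           (Pf : forall k (x : T k.+1), P x -> P (f x)).

(** The condition that x lifts n levels up to an element satisfying P.
    Recursion goes one level up from x, so that no arithmetic on the indices of
    T is needed. *)
Fixpoint extends n : forall k, T k -> Prop :=
  if n is n'.+1 then fun k x => exists2 x', f x' = x & extends n' x' else @P.

Let extendsW n k (x : T k) : extends n.+1 x -> extends n x.
Proof.
elim: n k x => [|n IH] k x; first by case=> x' <- /Pf.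
by case=> x' fx' /IH; exists x'.
Qed.

Let extends_le m n k (x : T k) : (m <= n)%N -> extends n x -> extends m x.
Proof. by move=> /subnK <-; elim: (n - m)%N => // l IH /extendsW. Qed.

Let pigeonhole k (Q : T k -> Prop) :
    (forall n, exists2 x, Q x & extends n x) ->
  exists2 x, Q x & forall n, extends n x.
Proof.
move=> hQ; apply: contrapT => none.
have bad x : {n | Q x -> ~ extends n x}.
  apply: cid; apply: contrapT => nbad; apply: none; exists x.
    by apply: contrapT => nQ; apply: nbad; exists 0%N.
  move=> n; apply: contrapT => ne; apply: nbad; exists n => _; exact: ne.
(* Every candidate fails to lift from some level on; the largest of these
   levels contradicts the hypothesis. *)
have [x Qx] := hQ (\max_x sval (bad x)).
move/(extends_le (leq_bigmax x)); exact: (svalP (bad x)).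
Qed.

(** Koenig's lemma in the form of compactness of an inverse limit of finite
    sets: an element that lifts arbitrarily far has, by the pigeonhole
    principle, a lift with the same property. *)
Lemma konig : exists x : forall k, T k, forall k, P (x k) /\ f (x k.+1) = x k.
Proof.
have [||s hs] := @dependent_choice T (fun k x => forall n, extends n x)
  (fun k x y => f y = x).
- have [|x _ gx] := @pigeonhole 0 (fun=> True); last by exists x.
  move=> n; suff [x ex] : exists x : T 0%N, extends n x by exists x.
  elim: n 0%N => [|n IH] k /=; first exact: exP.
  by have [x ex] := IH k.+1; exists (f x), x.
- move=> k x gx; have [|y fy gy] := @pigeonhole k.+1 (fun y => f y = x).
    by move=> n; apply: (gx n.+1).
  by exists y.
by exists s => k; have [h1 h2] := hs k; split=> //; apply: (h1 0%N).
Qed.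
End Konig.

Section RingLimProj.
Variables (S : ringsys) (n : nat).
Definition rproj (x : ringlim S) : S n := x n.
Fact rproj_is_zmod_morphism : zmod_morphism rproj. Proof. by []. Qed.
Fact rproj_is_monoid_morphism : monoid_morphism rproj. Proof. by []. Qed.
HB.instance Definition _ := GRing.isZmodMorphism.Build _ _ rproj
  rproj_is_zmod_morphism.
HB.instance Definition _ := GRing.isMonoidMorphism.Build _ _ rproj
  rproj_is_monoid_morphism.
End RingLimProj.

Section Frobenius.
Variables (q : nat) (R : comNzRingType).
Hypothesis q_pr : prime q.

Lemma frobenius_mod (x y : R) :
  exists z, (x + y) ^+ q = x ^+ q + y ^+ q + q%:R * z.
Proof.
case: q q_pr => // r r_pr.
exists (\sum_(i < r) (x ^+ (r.+1 - i.+1) * y ^+ i.+1) *+ ('C(r.+1, i.+1) %/ r.+1)).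
rewrite exprDn big_ord_recl /= bin0 subn0 expr0 mulr1 mulr1n -addrA; congr (_ + _).
rewrite big_ord_recr /= /bump !add1n binn subnn expr0 mul1r mulr1n addrC mulr_sumr.
congr (_ + _); apply: eq_bigr => i _; rewrite !add1n mulr_natl -mulrnA divnK //.
by rewrite prime_dvd_bin //= ltnS.
Qed.

(** The freshman's dream modulo q, iterated. *)
Lemma frobenius_iter k (x y : R) :
  exists z, (x + y) ^+ (q ^ k) = x ^+ (q ^ k) + y ^+ (q ^ k) + q%:R * z.
Proof.
elim: k => [|k [z IH]]; first by exists 0; rewrite !expr1 mulr0 addr0.
rewrite expnSr !exprM IH.
have [z1 ->] := frobenius_mod (x ^+ (q ^ k) + y ^+ (q ^ k)) (q%:R * z).
have [z2 ->] := frobenius_mod (x ^+ (q ^ k)) (y ^+ (q ^ k)).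
exists (z2 + q%:R ^+ q.-1 * z ^+ q + z1).
have -> : (q%:R * z) ^+ q = q%:R * (q%:R ^+ q.-1 * z ^+ q).
  by rewrite exprMn mulrA -exprS prednK ?prime_gt0.
by rewrite !mulrDr !addrA.
Qed.
End Frobenius.

Section LambdaTopology.
Variable q : nat.
Local Notation L := (Lambda q).

Definition Lfin k : finType := {ffun Gam q k -> 'Z_(q ^ k.+1)}.

(** The finite quotients (Z/q^(k+1))[Gamma/Gamma^(q^k)] of Lambda. The diagonal
    family is enough to define the topology of Lambda and can be handled as a
    single inverse system. *)
Definition Lred k : {rmorphism L -> grpring 'Z_(q ^ k.+1) (Gam q k)} :=
  gmap (@rproj (Zq_sys q) k) \o @rproj (Lambda_sys q) k.

Lemma LredE k (x : L) g : Lred k x g = x k g k.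
Proof. by rewrite /= ffunE. Qed.

Lemma Zq_sumE (I : finType) (P : pred I) (F : I -> Zq q) n :
  (\sum_(i | P i) F i : Zq q) n = \sum_(i | P i) F i n.
Proof. exact: (raddf_sum (@rproj (Zq_sys q) n)). Qed.

Lemma Lambda_gpush (x : L) k g n :
  x k g n = \sum_(h | Gam_proj h == g) x k.+1 h n.
Proof.
rewrite -[in LHS](ringlimP x k) ffunE.
exact: Zq_sumE.
Qed.

Lemma Lred_step k (x y : L) : Lred k.+1 x = Lred k.+1 y -> Lred k x = Lred k y.
Proof.
move=> exy; apply/ffunP => g; rewrite !LredE !Lambda_gpush; apply: eq_bigr => h _.
rewrite -[LHS](ringlimP (x k.+1 h) k) -[RHS](ringlimP (y k.+1 h) k).
by rewrite -!LredE exy.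
Qed.

Let downward (P : nat -> Prop) K n :
  (forall i, P i.+1 -> P i) -> (n <= K)%N -> P K -> P n.
Proof. by move=> PS /subnK <-; elim: (K - n)%N => // l IH /PS. Qed.

(** The K-th quotient determines the coefficients at every smaller level of the
    group and at every smaller precision; this makes sequences indexed by the
    diagonal as good as doubly indexed ones. *)
Lemma Lred_coef K (x y : L) : Lred K x = Lred K y ->
  forall m n g, (m <= K)%N -> (n <= K)%N -> x m g n = y m g n.
Proof.
move=> exy m n g mK nK; move: g.
apply: (downward (P := fun m => forall g, x m g n = y m g n) _ mK) => [i IH g|g].
  by rewrite !Lambda_gpush; apply: eq_bigr => h _; apply: IH.
apply: (downward (P := fun n => x K g n = y K g n) _ nK) => [i IH|].
  by rewrite -(ringlimP (x K g)) -(ringlimP (y K g)) IH.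
by rewrite -!LredE exy.
Qed.

Lemma Lred_inj (x y : L) : (forall k, Lred k x = Lred k y) -> x = y.
Proof.
move=> exy; apply: ringlim_ext => m; apply/ffunP => g; apply: ringlim_ext => n.
by apply: (Lred_coef (exy (m + n)%N)); rewrite ?leq_addr ?leq_addl.
Qed.

(** The limit takes its coefficients at level m and precision n from the (m +
    n)-th term of the sequence. *)
Lemma Lambda_complete (d : nat -> L) :
  (forall k, Lred k (d k.+1) = Lred k (d k)) ->
  exists c, forall k, Lred k c = Lred k (d k).
Proof.
move=> dS.
(* From index max(m, n) on the coefficients at (m, n) no longer depend on the
   term of the sequence. *)
have dE K m n g : (m <= K)%N -> (n <= K)%N -> d K m g n = d (m + n)%N m g n.
  move=> mK nK; have dm j : (m <= j)%N -> (n <= j)%N -> d j.+1 m g n = d j m g n.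
    by move=> mj nj; apply: (Lred_coef (dS j)).
  have aux J i : (m <= J)%N -> (n <= J)%N -> d (i + J)%N m g n = d J m g n.
    move=> mJ nJ; elim: i => // i <-; apply: dm.
      by rewrite (leq_trans mJ) ?leq_addl.
    by rewrite (leq_trans nJ) ?leq_addl.
  have mnJ : (maxn m n <= K)%N by rewrite geq_max mK.
  have mnJ' : (maxn m n <= m + n)%N by rewrite geq_max leq_addr leq_addl.
  rewrite -(subnK mnJ) -(subnK mnJ') !aux ?leq_maxl ?leq_maxr //.
have cP1 m g n : zmod_red (d (m + n.+1)%N m g n.+1) = d (m + n)%N m g n.
  rewrite (ringlimP (d (m + n.+1)%N m g) n).
  by rewrite dE // ?leq_addr // addnS ltnW // ltnS leq_addl.
pose c1 m g : Zq q := @RingLim (Zq_sys q) (fun n => d (m + n)%N m g n) (cP1 m g).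
have cP2 m : gpush (@Gam_proj q m) [ffun g => c1 m.+1 g] = [ffun g => c1 m g].
  apply/ffunP => g; rewrite !ffunE; apply: ringlim_ext => n.
  rewrite Zq_sumE.
  transitivity (d (m.+1 + n)%N m g n); last first.
    by apply: dE; rewrite addSn ltnW // ltnS ?leq_addr ?leq_addl.
  by rewrite Lambda_gpush; apply: eq_bigr => h _; rewrite ffunE.
exists (@RingLim (Lambda_sys q) (fun m => [ffun g => c1 m g]) cP2) => k.
by apply/ffunP => g; rewrite !LredE /= ffunE /= -(dE k).
Qed.

(** Compactness of a finite power of Lambda: a decreasing sequence of nonempty
    closed conditions, the k-th of which only depends on the k-th finite
    quotient, has a common solution. *)
Lemma Lambda_compact (I : finType) (C : nat -> (I -> L) -> Prop) :
    (forall k d d', (forall i, Lred k (d i) = Lred k (d' i)) ->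
       C k d -> C k d') ->
    (forall k d, C k.+1 d -> C k d) ->
    (forall k, exists d, C k d) ->
  exists d, forall k, C k d.
Proof.
move=> Cred CS exC.
pose T k : finType := {ffun I -> Lfin k}.
pose red k (d : I -> L) : T k := [ffun i => Lred k (d i)].
pose P k (y : T k) := exists2 d, C k d & y = red k d.
pose f k (y : T k.+1) : T k :=
  [ffun i => gpush (@Gam_proj q k) (gmap (@zmod_red q k) (y i))].
have fred k d : f k (red k.+1 d) = red k d.
  apply/ffunP => i; rewrite !ffunE; apply/ffunP => g.
  rewrite LredE Lambda_gpush !ffunE.
  apply: eq_bigr => h _; rewrite !ffunE.
  exact: (ringlimP (d i k.+1 h) k).
have [k|k y [d Cd ->]|x xP] := @konig T f P.
- by have [d Cd] := exC k; exists (red k d), d.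
- by exists d; [apply: CS | rewrite fred].
have /choice[d dP] k : exists d, C k d /\ x k = red k d.
  by have [[d Cd ->] _] := xP k; exists d.
have xE k i : x k i = Lred k (d k i) by have [_ ->] := dP k; rewrite ffunE.
have /choice[c cP] i : exists c, forall k, Lred k c = Lred k (d k i).
  apply: Lambda_complete => k.
  have := congr1 (fun y : T k => y i) (xP k).2.
  by rewrite /= (dP k.+1).2 fred ffunE xE.
exists c => k; apply: (Cred k (d k)) => [i|]; [by rewrite cP | exact: (dP k).1].
Qed.

Lemma Lambda_principal_closed (c d : L) :
  (forall k, exists e, Lred k (e * d) = Lred k c) -> exists e, c = e * d.
Proof.
move=> ex.
have [k e e' ee'|k e|k|e eP] :=
    @Lambda_compact unit (fun k e => Lred k (e tt * d) = Lred k c).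
- by rewrite !rmorphM /= -[LHS]/(Lred k (e tt) * Lred k d) ee'.
- exact: Lred_step.
- by have [e eE] := ex k; exists (fun=> e).
by exists (e tt); apply: Lred_inj => k; rewrite eP.
Qed.
End LambdaTopology.

Section LambdaUnits.
Variable q : nat.
Hypothesis q_pr : prime q.
Local Notation L := (Lambda q).

Lemma Gam_card m : ((q ^ m).-1.+1 = q ^ m)%N.
Proof. by rewrite prednK // expn_gt0 prime_gt0. Qed.

Lemma theta_mulrn m i : theta_ q m *+ i = inZp i.
Proof.
elim: i => [|i IH]; first by apply: val_inj; rewrite /= mod0n.
by rewrite mulrS IH; apply: val_inj; rewrite /= modnDm add1n.
Qed.

Lemma theta_val m (g : Gam q m) : theta_ q m *+ g = g.
Proof. by rewrite theta_mulrn valZpK. Qed.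

Lemma theta_order m : theta_ q m *+ (q ^ m) = 0.
Proof. by rewrite theta_mulrn; apply: val_inj; rewrite /= Gam_card modnn. Qed.

Lemma Lred_q k : Lred q k (q%:R ^+ k.+1) = 0.
Proof.
rewrite -natrX rmorph_nat -(rmorph_nat (gsingle 0)).
have -> : (q ^ k.+1)%:R = 0 :> 'Z_(q ^ k.+1).
  apply: pchar_Zp; apply: (leq_trans (prime_gt1 q_pr)).
  by rewrite expnS leq_pmulr // expn_gt0 prime_gt0.
by rewrite raddf0.
Qed.

(** Modulo q, the power q^k of theta - 1 is theta^(q^k) - 1, which vanishes in
    Z[Gamma/Gamma^(q^k)]; so this power is a multiple of q, and q^(k+1) is zero
    in the quotient. *)
Lemma Lred_thetaB1_nilpotent k :
  Lred q k ((theta q - 1) ^+ (q ^ k * k.+1)) = 0.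
Proof.
have [z ez] := frobenius_iter q_pr k (theta q - 1) 1.
have e : Lred q k ((theta q - 1) ^+ (q ^ k)) = Lred q k (- q%:R * z).
  have : Lred q k (theta q ^+ (q ^ k)) = 1.
    by rewrite rmorphXn /= gmap_single rmorph1 gsingle_exp theta_order expr1n.
  move=> h; have := congr1 (Lred q k) ez.
  rewrite subrK expr1n h 2!rmorphD rmorph1 addrAC -[LHS]add0r => /addIr /eqP.
  by rewrite eq_sym addr_eq0 => /eqP ->; rewrite mulNr rmorphN.
rewrite exprM rmorphXn e -rmorphXn exprMn exprNn mulrAC.
by rewrite rmorphM Lred_q mulr0.
Qed.

(** Lambda is local with residue field Z/q: an inverse exists in each finite
    quotient, by a geometric series in a nilpotent multiple of theta - 1, and
    principal ideals are closed. *)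
Lemma Lambda_unit (c : nat) (y : L) : coprime q c ->
  exists e, e * (c%:R + (theta q - 1) * y) = 1.
Proof.
move=> qc; suff [e e1] : exists e, 1 = e * (c%:R + (theta q - 1) * y) by exists e.
apply: Lambda_principal_closed => k.
have qk0 : (0 < q ^ k.+1)%N by rewrite expn_gt0 prime_gt0.
have [b _] := Bezoutl c qk0.
rewrite (eqP (_ : coprime (q ^ k.+1) c)) ?coprimeXl // => /dvdnP[s bs].
pose r : L := b%:R * (theta q - 1) * y; pose N := (q ^ k * k.+1)%N.
(* Here 1 + b c is divisible by q^(k+1), so - b inverts c at this level, and r
   is the nilpotent part of the product of b with the given element. *)
exists (- b%:R * \sum_(i < N) r ^+ i).
have eb : Lred q k (- b%:R * (c%:R + (theta q - 1) * y)) = Lred q k (1 - r).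
  apply/eqP; rewrite -subr_eq0 -rmorphB mulrDr /r !mulNr !mulrA opprB.
  rewrite addrA subrK -opprD -natrM addrC nat1r -(add1n (b * c)%N) bs.
  by rewrite natrM natrX rmorphN rmorphM Lred_q mulr0 oppr0.
have rN : Lred q k (r ^+ N) = 0.
  by rewrite /r mulrAC mulrC exprMn rmorphM Lred_thetaB1_nilpotent mul0r.
rewrite mulrAC rmorphM eb -rmorphM -opprB mulNr -subrX1 opprB rmorphB rN subr0.
by rewrite !rmorph1.
Qed.

(** Lifting a group element to the power of theta that represents it. *)
Lemma Lambda_lift m (x : grpring (Zq q) (Gam q m)) : exists y : L, y m = x.
Proof.
exists (\sum_g Lambda_const (x g) * theta q ^+ (g : 'I_(q ^ m).-1.+1)).
rewrite -[LHS]/(@rproj (Lambda_sys q) m _) raddf_sum [RHS]grpring_sumE.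
apply: eq_bigr => g _.
rewrite -[LHS]/(rproj m (Lambda_const (x g)) * rproj m (theta q ^+ g)).
rewrite rmorphXn /= /rproj /=.
by rewrite gsingle_exp theta_val expr1n gsingleM add0r mulr1.
Qed.
End LambdaUnits.

(** * A presentation of the Bowen-Franks module of a constant tower *)

Section TensorSums.
Variables M N : zmodType.

Lemma tens_suml (I : finType) (P : pred I) (F : I -> M) (n : N) :
  tens (\sum_(i | P i) F i) n = \sum_(i | P i) tens (F i) n.
Proof. 
have h0 : tens (0 : M) n = 0 := tens0r M n.
exact: (big_morph (fun x : M => tens x n) (fun x y => tensDl x y n) h0). Qed.

Lemma tens_mulz (m : M) (n : N) (z : int) : tens (m *~ z) n = tens m (n *~ z).
Proof.
have tn (x : M) (y : N) k : tens (x *+ k) y = tens x (y *+ k).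
  by elim: k => [|k IH]; rewrite ?tens0r ?tensr0 // !mulrS tensDl tensDr IH.
have tN (x : M) (y : N) : tens (- x) y = tens x (- y).
  by apply: (addrI (tens x y)); rewrite -tensDl -tensDr !subrr tens0r tensr0.
case: z => k; first exact: tn.
by have := tn m (- n) k.+1; rewrite mulNrn -tN.
Qed.
End TensorSums.

Lemma div_sumE (V : finType) (D : Div V) : D = \sum_w vtx w *~ D w.
Proof.
apply/ffunP => v; rewrite sum_ffunE (bigD1 v) //= big1 => [|w /negPf wv].
  by rewrite addr0 ffunMzE ffunE eqxx intz.
by rewrite ffunMzE ffunE eq_sym wv mul0rz.
Qed.

Lemma adjE (X : digraph) (D : Div (vert X)) w :
  adj D w = \sum_(E : edge X | ter E == w) D (org E).
Proof.
rewrite /adj /divext sum_ffunE.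
under eq_bigr => v _ do rewrite ffunMzE sum_ffunE -[_ *~ _]mulrzl.
rewrite [RHS]big_mkcond (partition_big (@org X) predT) //=; apply: eq_bigr => v _.
rewrite mulr_sumr; apply: eq_bigr => E /eqP <-.
by rewrite ffunE eq_sym intz; case: eqP => _; rewrite ?mulr1 ?mulr0.
Qed.

(** The combination of the relations w_v = th (the sum of the w_t(e) over the
    edges e leaving v) with coefficients d, as a function on vertices; it is
    the transpose of Id - th A_X applied to d. *)
Definition relcomb (X : digraph) (R : comNzRingType) (th : R) (d : vert X -> R)
  (v : vert X) : R := d v - th * \sum_(e | ter e == v) d (org e).

Section Level.
Local Open Scope quotient_scope.
Variables (q : nat) (X : digraph) (m : nat).
Local Notation Y := (layer X q m).
Local Notation A := (Gam q m).
Local Notation Lm := (grpring (Zq q) A).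
Local Notation M := (scext (Zq q) (bf_layer q X m)).

Definition bf_vtx v g : BF Y := \pi_(BF Y) (vtx ((v, g) : vert Y)).
(** The translations by Gamma_m carry the vertices (v, 0) to all vertices of
    X_m, so these vertices generate BF(X_m) over the group ring. *)
Definition level_gen (v : vert X) : M := tens (bf_vtx v 0 : bf_layer q X m) 1.

Lemma scale_level_gen (c : Lm) v :
  c *: level_gen v = \sum_g tens (bf_vtx v g : bf_layer q X m) (c g).
Proof.
rewrite /GRing.scale /= scext_scale_tens; apply: eq_bigr => g _.
rewrite mulr1; congr tens; rewrite /= bfmap_pi /push divext_vtx /=.
by rewrite /derived_fun /= addr0.
Qed.

Definition level_comb (c : vert X -> Lm) : M := \sum_v c v *: level_gen v.

Lemma level_combB c c' :
  level_comb (fun v => c v - c' v) = level_comb c - level_comb c'.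
Proof. by rewrite -sumrB; apply: eq_bigr => v _; rewrite scalerBl. Qed.

Lemma eq_level_comb c c' : c =1 c' -> level_comb c = level_comb c'.
Proof. by move=> cc'; apply: eq_bigr => v _; rewrite cc'. Qed.

Lemma level_gen_span (x : M) : exists c, x = level_comb c.
Proof.
rewrite /level_comb; elim/tensor_ind: x => [x y [c ->] [d ->]|x [c ->]|b r].
- exists (fun v => c v + d v); rewrite -big_split.
  by apply: eq_bigr => v _; rewrite scalerDl.
- by exists (fun v => - c v); rewrite -sumrN; apply: eq_bigr => v _; rewrite scaleNr.
elim/quotW: b => D; exists (fun v => [ffun g => r *~ D (v, g)]).
under eq_bigr => v _ do rewrite scale_level_gen.
rewrite pair_big /= {1}(div_sumE D) raddf_sum tens_suml; apply: eq_bigr => -[v g] _.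
by rewrite /= ffunE raddfMz tens_mulz.
Qed.

Lemma pi_adj D : \pi_(BF Y) (adj D) = \pi_(BF Y) D.
Proof.
apply/esym/eqP; rewrite -Quotient.idealrBE; apply/asboolP; by exists D.
Qed.

Lemma level_gen_rel v :
  level_gen v = gsingle (theta_ q m) 1 *: \sum_(e | org e == v) level_gen (ter e).
Proof.
rewrite {1}/level_gen /bf_vtx -pi_adj adj_derived raddf_sum tens_suml scaler_sumr.
apply: eq_bigr => e _; rewrite scale_level_gen (bigD1 (theta_ q m)) //= ffunE eqxx.
rewrite big1 ?addr0 ?add0r // => g /negPf gt.
by rewrite ffunE gt tensr0.
Qed.

Local Notation th := (gsingle (theta_ q m) 1 : Lm).

Definition relcomb_ffun (d : {ffun vert X -> Lm}) : {ffun vert X -> Lm} :=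
  [ffun v => relcomb th d v].
Fact bndf_is_zmod_morphism : zmod_morphism relcomb_ffun.
Proof.
move=> d d'; apply/ffunP => v; rewrite !ffunE /relcomb !ffunE.
under eq_bigr => e _ do rewrite !ffunE.
by rewrite sumrB mulrBr !opprD !opprK addrACA.
Qed.
HB.instance Definition _ := GRing.isZmodMorphism.Build _ _ relcomb_ffun
  bndf_is_zmod_morphism.

Local Notation Q := (Quotient.quot (im_pred relcomb_ffun)).

(** A divisor on the layer X_m is an X-indexed family of elements of the group
    ring; after extending the scalars this identifies the module to be
    presented with a cokernel. *)
Definition chain (D : Div (vert Y)) (r : Zq q) : {ffun vert X -> Lm} :=
  [ffun v => [ffun g => r *~ D (v, g)]].

Lemma chainDl D D' r : chain (D + D') r = chain D r + chain D' r.
Proof.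
by apply/ffunP => v; apply/ffunP => g; rewrite !ffunE mulrzDr.
Qed.

Lemma chainDr D r r' : chain D (r + r') = chain D r + chain D r'.
Proof.
by apply/ffunP => v; apply/ffunP => g; rewrite !ffunE mulrzDl.
Qed.

(** The translation by theta built into the edges of X_m becomes multiplication
    by theta in the group ring. *)
Lemma chain_adj D r : chain (D - adj D) r = relcomb_ffun (chain D r).
Proof.
apply/ffunP => v; apply/ffunP => g.
have -> : relcomb_ffun (chain D r) v g = chain D r v g -
    (th * \sum_(e | ter e == v) chain D r (org e)) g.
  by rewrite /relcomb_ffun ffunE /relcomb [LHS]ffunE; congr (_ + _); rewrite [LHS]ffunE.
rewrite gsingle_shift sum_ffunE !ffunE mulrzBr adjE raddf_sum /=; congr (_ - _).
rewrite (eq_bigl (fun E : edge X * A => (ter E.1 == v) && (E.2 == g - theta_ q m))).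
  rewrite -(pair_big_dep (fun e => ter e == v) (fun _ k => k == g - theta_ q m)
    (fun e k => r *~ D (org e, k))) /=.
  by apply: eq_bigr => e _; rewrite big_pred1_eq !ffunE.
by move=> [e k]; rewrite xpair_eqE /= (can2_eq (addrK _) (subrK _)).
Qed.

Definition chain_class (b : BF Y) (r : Zq q) : Q := \pi_Q (chain (repr b) r).

Lemma chain_class_pi D r : chain_class (\pi_(BF Y) D) r = \pi_Q (chain D r).
Proof.
apply/eqP; rewrite -Quotient.idealrBE.
have /asboolP[D' eD] : bf_rel (repr (\pi_(BF Y) D) - D).
  by rewrite -[bf_rel _]/(_ \in (@bf_rel Y)) Quotient.idealrBE reprK.
apply/asboolP; exists (chain D' r).
rewrite -[RHS]/(relcomb_ffun (chain D' r)) -chain_adj -eD.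
by apply/eqP; rewrite subr_eq -chainDl subrK.
Qed.

Lemma chain_classDl b b' r :
  chain_class (b + b') r = chain_class b r + chain_class b' r.
Proof.
elim/quotW: b => D; elim/quotW: b' => D'.
by rewrite -[in LHS]raddfD !chain_class_pi chainDl raddfD.
Qed.

Lemma chain_classDr b r r' :
  chain_class b (r + r') = chain_class b r + chain_class b r'.
Proof. by rewrite /chain_class chainDr raddfD. Qed.

(** The map from the module to the cokernel of the relation map, induced by
    reading divisors as chains, sends a combination of generators to the class
    of its coefficients. *)
Lemma level_gen_kernel (c : vert X -> Lm) :
  level_comb c = 0 -> exists d, forall v, c v = relcomb th d v.
Proof.
rewrite /level_comb => c0; pose k : {additive tensor (BF Y) (Zq q) -> Q} := HB.pack_for
  {additive tensor (BF Y) (Zq q) -> Q} (tlift chain_class)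
  (GRing.isZmodMorphism.Build _ _ (tlift chain_class)
    (tlift_is_zmod_morphism chain_classDl chain_classDr)).
have kt b r : k (tens b r) = chain_class b r by apply: tlift_tens;
  [apply: chain_classDl | apply: chain_classDr].
have : k (\sum_v c v *: level_gen v) = \pi_Q [ffun v => c v].
  rewrite raddf_sum.
  under eq_bigr => v _ do rewrite scale_level_gen raddf_sum.
  under eq_bigr => v _ do under eq_bigr => g _ do rewrite kt chain_class_pi.
  under eq_bigr => v _ do rewrite -raddf_sum.
  rewrite -raddf_sum; congr (\pi_Q _).
  apply/ffunP => v; apply/ffunP => g; rewrite sum_ffunE ffunE sum_ffunE.
  rewrite (bigD1 v) //= sum_ffunE sum_ffunE (bigD1 g) //= !ffunE eqxx mulr1z.
  rewrite big1 ?addr0 => [|h hg]; last first.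
    by rewrite !ffunE xpair_eqE eqxx eq_sym (negPf hg) mulr0z.
  rewrite big1 ?addr0 // => w wv; rewrite sum_ffunE sum_ffunE big1 // => h _.
  by rewrite !ffunE xpair_eqE eq_sym (negPf wv) mulr0z.
rewrite c0 raddf0 => /esym/eqP; rewrite -(raddf0 (\pi_Q)) -Quotient.idealrBE subr0.
case/asboolP => d /ffunP ed; exists d => v.
by have := ed v; rewrite !ffunE.
Qed.
End Level.

Lemma rmorph_relcomb (X : digraph) (R R' : comNzRingType) (f : {rmorphism R -> R'})
  (th : R) (d : vert X -> R) v : f (relcomb th d v) = relcomb (f th) (f \o d) v.
Proof. by rewrite /relcomb rmorphB rmorphM rmorph_sum. Qed.

(** Summation by parts over the edges. *)
Lemma sum_relcomb (X : digraph) (R : comNzRingType) (M : lmodType R) (th : R)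
    (w : vert X -> M) (d : vert X -> R) :
  \sum_v relcomb th d v *: w v =
  \sum_v d v *: (w v - th *: \sum_(e | org e == v) w (ter e)).
Proof.
under eq_bigr => v _ do rewrite scalerBl -scalerA scaler_suml scaler_sumr.
under [RHS]eq_bigr => v _ do rewrite scalerBr scaler_sumr scaler_sumr.
rewrite !sumrB; congr (_ - _).
rewrite (exchange_big_dep predT) //= [RHS](exchange_big_dep predT) //=.
apply: eq_bigr => e _.
rewrite (big_pred1 (ter e)) => [|v]; last by rewrite eq_sym.
rewrite (big_pred1 (org e)) => [|v]; last by rewrite eq_sym.
by rewrite !scalerA mulrC.
Qed.

Section ModLimProj.
Variables (S : ringsys) (M : modsys S) (n : nat).
Definition mproj (x : modlim M) : M n := x n.
Fact mproj_is_zmod_morphism : zmod_morphism mproj. Proof. by []. Qed.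
HB.instance Definition _ := GRing.isZmodMorphism.Build _ _ mproj
  mproj_is_zmod_morphism.
End ModLimProj.

Section Presentation.
Variables (q : nat) (X : digraph).
Local Notation L := (Lambda q).
Local Notation V := (vert X).

Fact bfgenP (v : V) m :
  modsys_tr (BF_sys q X) m (level_gen q m.+1 v) = level_gen q m v.
Proof.
rewrite /= /scext_map tmap_tens /= bfmap_pi /push divext_vtx /level_gen /bf_vtx /=.
by rewrite /derived_fun /= raddf0.
Qed.
Definition bfgen (v : V) : BF_inf q X := @ModLim _ (BF_sys q X) _ (bfgenP v).

Lemma bf_combE (c : V -> L) m :
  (\sum_v c v *: bfgen v) m = level_comb (fun v => c v m).
Proof. exact: (raddf_sum (@mproj _ (BF_sys q X) m)). Qed.

Lemma bfgen_rel (v : V) : bfgen v = theta q *: \sum_(e | org e == v) bfgen (ter e).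
Proof.
apply: modlim_ext => m; rewrite [LHS]level_gen_rel.
have <- : mproj m (\sum_(e | org e == v) bfgen (ter e)) =
  \sum_(e | org e == v) level_gen q m (ter e) by rewrite raddf_sum.
by [].
Qed.

Let Lrelcomb (d : V -> L) (v : V) : L := relcomb (theta q) d v.

(** Coefficients are chosen level by level. Two choices at the same level
    differ by relations, and relations lift to the next level, so each choice
    can be corrected to lift the previous one. *)
Lemma bfgen_span (x : BF_inf q X) : exists c, x = \sum_v c v *: bfgen v.
Proof.
have lift m (d : V -> grpring (Zq q) (Gam q m)) :
  exists D : V -> L, forall v, D v m = d v.
  by have /choice[D DE] v := Lambda_lift (d v); exists D.
have lrel m (D : V -> L) : level_comb (fun v => Lrelcomb D v m) = 0.
  rewrite /level_comb; under eq_bigr => v _ do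
    rewrite -[Lrelcomb _ _ m]/(rproj m (relcomb (theta q) D v)) rmorph_relcomb.
  rewrite sum_relcomb big1 // => v _; rewrite [X in X - _]level_gen_rel.
  by rewrite subrr scaler0.
(* The coefficients at level m are carried by elements of Lambda, of which only
   the component m matters. *)
have [|m c xc|s sP] := @dependent_choice (fun=> V -> L)
  (fun m c => x m = level_comb (fun v => c v m))
  (fun m c c' => forall v, c' v m = c v m).
- have [c ->] := level_gen_span (x 0%N); have [C CE] := lift _ c; exists C.
  by apply: eq_level_comb => v; rewrite CE.
- have [c0 xc0] := level_gen_span (x m.+1); have [c1 c1E] := lift _ c0.
  have xc1 : x m = level_comb (fun v => c1 v m).
    rewrite -(modlimP x) xc0 raddf_sum; apply: eq_bigr => v _.
    by rewrite modsys_trZ bfgenP -c1E ringlimP.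
  have [|d dE] := @level_gen_kernel q X m (fun v => c1 v m - c v m).
    by rewrite level_combB -xc -xc1 subrr.
  have [D DE] := lift _ d.
  exists (fun v => c1 v - relcomb (theta q) D v) => [|v].
    rewrite -[RHS]/(level_comb (fun v => c1 v m.+1 - Lrelcomb D v m.+1)).
    by rewrite level_combB lrel subr0 xc0; apply: eq_level_comb => v; rewrite c1E.
  rewrite -[LHS]/(c1 v m - rproj m (relcomb (theta q) D v)) rmorph_relcomb.
  rewrite -[c1 v m](subrK (c v m)) dE addrAC; apply/eqP.
  rewrite -subr_eq0 addrK subr_eq0; apply/eqP; congr (_ - _).
    by rewrite -DE.
  by congr (_ * _); apply: eq_bigr => e _; rewrite -DE.
have cP v m : ringsys_tr (Lambda_sys q) m (s m.+1 v m.+1) = s m v m.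
  by rewrite ringlimP; case: (sP m) => _ ->.
exists (fun v => @RingLim (Lambda_sys q) (fun m => s m v m) (cP v)).
apply: modlim_ext => m; rewrite bf_combE; exact: (sP m).1.
Qed.

(** At each level a vanishing combination is a combination of relations; by
    compactness the coefficients can be chosen in Lambda. *)
Lemma bfgen_kernel (c : V -> L) :
  \sum_v c v *: bfgen v = 0 -> exists d, forall v, c v = relcomb (theta q) d v.
Proof.
move=> c0.
have [k d d' dd' Cd v|k d Cd v|k|d dP] := @Lambda_compact q V
  (fun k d => forall v, Lred q k (relcomb (theta q) d v) = Lred q k (c v)).
- rewrite -Cd !rmorph_relcomb /relcomb; congr (_ - _ * _); first exact: (esym (dd' _)).
  by apply: eq_bigr => e _; apply: (esym (dd' _)).
- exact: Lred_step.
- have [|d dE] := @level_gen_kernel q X k (fun v => c v k).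
    by rewrite -bf_combE c0.
  have /choice[D DE] v := Lambda_lift (d v); exists D => v.
  congr (gmap _ _); rewrite rmorph_relcomb; apply: etrans (esym (dE v)).
  rewrite /relcomb; congr (_ - _ * _).
    exact: DE.
  by apply: eq_bigr => e _; apply: DE.
by exists d => v; apply: Lred_inj => k; rewrite dP.
Qed.
End Presentation.

(** * Normal forms in the metacyclic group *)

Section AffineGroup.
Variables (p a : nat).
Hypotheses (p_pr : prime p) (a_prim : p.-1.-primitive_root (a%:R : 'F_p)).
Local Notation al := (a%:R : 'F_p).
Local Open Scope group_scope.

Let al_neq0 : al != 0. Proof. exact: prim_root_neq0 a_prim. Qed.

Fact shift_inj : injective (fun x : 'F_p => x + 1)%R. Proof. exact: addIr. Qed.
Fact scale_inj : injective (fun x : 'F_p => x * al^-1)%R.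
Proof. by apply: mulIf; rewrite invr_eq0. Qed.
Definition aff_s : {perm 'F_p} := perm shift_inj.
(** Permutations compose from left to right, so division by a is the map that
    conjugates the translation to its a-th power. *)
Definition aff_t : {perm 'F_p} := perm scale_inj.

Lemma aff_sX i x : (aff_s ^+ i) x = (x + i%:R)%R.
Proof.
elim: i x => [|i IH] x; first by rewrite expg0 perm1 addr0.
by rewrite expgSr permM IH permE -addrA -natr1.
Qed.

Lemma aff_tX j x : (aff_t ^+ j) x = (x * al ^- j)%R.
Proof.
elim: j x => [|j IH] x; first by rewrite expg0 perm1 expr0 invr1 mulr1.
by rewrite expgSr permM IH permE -mulrA -invfM -exprSr.
Qed.

Definition aff_group : {group {perm 'F_p}} := <<[set aff_s; aff_t]>>%G.

(** The affine group of the line over 'F_p satisfies the defining relations; it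
    serves to bound the order of the presented group from below. *)
Lemma aff_group_homg :
  aff_group \homg Grp (s : t : (s ^+ p, t ^+ p.-1, t * s * t^-1 = s ^+ a)).
Proof.
apply/existsP; exists (aff_s, aff_t); rewrite /= !xpair_eqE.
apply/and4P; split.
- by rewrite joing_idl joing_idr eqxx.
- apply/eqP/permP => x; rewrite aff_sX perm1.
  by have -> : p%:R = 0 :> 'F_p; rewrite ?addr0 //; apply: pcharf0 (pchar_Fp p_pr).
- apply/eqP/permP => x.
  by rewrite aff_tX perm1 (prim_expr_order a_prim) invr1 mulr1.
apply/eqP; apply: (canLR (mulgK _)); apply/permP => x.
by rewrite !permM aff_sX !permE mulrDl mulfV.
Qed.

Lemma card_aff_group : (p * p.-1 <= #|aff_group|)%N.
Proof.
pose f (ij : 'F_p * 'I_p.-1) := aff_s ^+ ij.1 * aff_t ^+ ij.2.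
have fE ij x : f ij x = ((x + ij.1%:R) * al ^- ij.2)%R.
  by rewrite permM aff_sX aff_tX.
have finj : injective f.
  move=> [i j] [i' j'] e.
  have h x : ((x + i) * al ^- j = (x + i') * al ^- j')%R.
    by have := congr1 (fun s : {perm _} => s x) e; rewrite !fE /= !natr_Zp.
  have ej : j = j'.
    apply/val_inj/eqP; have := eq_prim_root_expr a_prim j j'.
    rewrite !modn_small // => <-; apply/eqP/invr_inj.
    have := h 1%R; rewrite !(addrC 1%R) !mulrDl !mul1r.
    by have := h 0%R; rewrite !add0r => -> /addrI.
  rewrite -ej in h *; have /eqP := h 0%R.
  rewrite !add0r (inj_eq (mulIf _)) ?invr_eq0 ?expf_neq0 // => /eqP -> //.
have <- : #|{: 'F_p * 'I_p.-1}| = (p * p.-1)%N.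
  by rewrite card_prod card_Fp // card_ord.
rewrite -(card_codom finj).
apply: subset_leq_card; apply/fintype.subsetP => _ /codomP[ij ->].
by rewrite groupM // groupX // mem_gen // !inE eqxx ?orbT.
Qed.
End AffineGroup.

Section NormalForm.
Variables (p a : nat) (gT : finGroupType) (sigma tau : gT).
Hypotheses (p_pr : prime p) (p_gt2 : (2 < p)%N).
Hypothesis a_prim : p.-1.-primitive_root (a%:R : 'F_p).
Hypothesis G_pres : ([set: gT] \isog
     Grp (s : t : (s ^+ p, t ^+ p.-1, t * s * t^-1 = s ^+ a)))%g.
Hypotheses (G_gen : [set: gT] = <<[set sigma; tau]>>%g)
  (sigma_p : (sigma ^+ p = 1)%g) (tau_p1 : (tau ^+ p.-1 = 1)%g)
  (conj_rel : (tau * sigma * tau^-1 = sigma ^+ a)%g).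
Local Notation al := (a%:R : 'F_p).

Lemma sigma_mod (i : nat) : (sigma ^+ (i%:R : 'F_p) = sigma ^+ i)%g.
Proof. by rewrite val_Fp_nat // expg_mod. Qed.

Lemma sigmaD (i j : 'F_p) : (sigma ^+ (i + j)%R = sigma ^+ i * sigma ^+ j)%g.
Proof. by rewrite -[in LHS](natr_Zp i) -[in LHS](natr_Zp j) -natrD sigma_mod expgD. Qed.

Lemma tauX_sigma j : (tau ^+ j * sigma = sigma ^+ (al ^+ j)%R * tau ^+ j)%g.
Proof.
rewrite -natrX sigma_mod; elim: j => [|j IH].
  by rewrite !expg0 mul1g expn0 expg1 mulg1.
have conjX i : (tau * sigma ^+ i = sigma ^+ (i * a) * tau)%g.
  have e : (tau * sigma = sigma ^+ a * tau)%g by rewrite -conj_rel mulgKV.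
  elim: i => [|i IHi]; first by rewrite !expg0 mul1g mulg1.
  by rewrite expgS mulgA e -mulgA IHi mulgA -expgD mulSn.
by rewrite expgS -mulgA IH mulgA conjX expnSr mulgA.
Qed.

Definition normal_form (ij : 'F_p * 'I_p.-1) : gT := (sigma ^+ ij.1 * tau ^+ ij.2)%g.

Lemma normal_form_sigma i j :
  (normal_form (i, j) * sigma = normal_form (i + al ^+ j, j)%R)%g.
Proof. by rewrite /normal_form /= -mulgA tauX_sigma mulgA -sigmaD. Qed.

Let p1_gt0 : (0 < p.-1)%N. Proof. by rewrite -ltnS prednK ?prime_gt0 // ltnW. Qed.

(** The normal forms contain 1 and are stable under right multiplication by
    both generators. *)
Lemma normal_form_surj x : exists ij, x = normal_form ij.
Proof.
have : x \in <<[set sigma; tau]>>%g by rewrite -G_gen inE.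
case/gen_prodgP => n [c cA ->].
elim: n c cA => [|n IH] c cA.
  by exists (0, Ordinal p1_gt0); rewrite big_ord0 /normal_form /= !expg0 mulg1.
rewrite big_ord_recr /=.
have [|[i j] ->] := IH (fun i => c (widen_ord (leqnSn n) i)).
  by move=> i; apply: cA.
have := cA ord_max; rewrite !inE => /orP[] /eqP ->.
  by rewrite normal_form_sigma; exists (i + al ^+ j, j).
pose j' : 'I_p.-1 := Ordinal (ltn_pmod j.+1 p1_gt0); exists (i, j').
by rewrite /normal_form /= -mulgA -expgSr expg_mod.
Qed.

(** There are p (p - 1) normal forms, and at least as many elements because the
    affine group is a quotient of the presented group. *)
Lemma normal_form_bij : bijective normal_form.
Proof.
have surj : codom normal_form =i [set: gT].
  move=> x; rewrite !inE; apply/codomP.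
  by have [ij ->] := normal_form_surj x; exists ij.
have cardT : (#|{: 'F_p * 'I_p.-1}| <= #|[set: gT]|)%N.
  rewrite card_prod card_Fp // card_ord.
  apply: leq_trans (card_aff_group p_pr a_prim) (leq_homg _).
  by rewrite G_pres; apply: aff_group_homg.
have/card_uniqP : #|codom normal_form| = size (codom normal_form).
  apply/eqP; rewrite eqn_leq card_size size_codom (leq_trans cardT) //.
  by rewrite (eq_card surj).
rewrite -[uniq _]/(injectiveb normal_form) => /injectiveP inj.
apply: (inj_card_bij inj).
by rewrite -cardsT -(eq_card surj) -(size_codom normal_form) card_size.
Qed.

Lemma sigma_neq_tau : sigma != tau.
Proof.
apply/eqP => st; have p1_gt1 : (1 < p.-1)%N by rewrite -ltnS prednK ?prime_gt0.
have := bij_inj normal_form_bij (x1 := (1, Ordinal p1_gt0)) (x2 := (0, Ordinal p1_gt1)).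
rewrite /normal_form /= !expg1 expg0 mulg1 mul1g => /(_ st).
by move/(congr1 (fun ij => val ij.2)).
Qed.
End NormalForm.

(** * The module presented by the Cayley graph *)

Section Structure.
Variables (p a : nat) (gT : finGroupType) (sigma tau : gT).
Hypotheses (p_pr : prime p) (a_prim : p.-1.-primitive_root (a%:R : 'F_p)).
Local Notation al := (a%:R : 'F_p).

Let al_pow_neq0 j : al ^+ j != 0.
Proof. by rewrite expf_neq0 // (prim_root_neq0 a_prim). Qed.

(** A primitive root enumerates the nonzero residues by its powers. *)
Lemma big_Fp_unit (T : Type) (idx : T) (op : Monoid.com_law idx) (F : 'F_p -> T) :
  \big[op/idx]_(k | k != 0) F k = \big[op/idx]_(j < p.-1) F (al ^+ j).
Proof.
rewrite -(big_map (fun j : 'I_p.-1 => al ^+ j) predT F).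
rewrite -big_filter; apply: perm_big; apply: uniq_perm.
- by rewrite filter_uniq // index_enum_uniq.
- by rewrite (map_inj_uniq (prim_pow_inj a_prim)) index_enum_uniq.
move=> k; rewrite mem_filter mem_index_enum andbT.
apply/idP/mapP => [k0|[j _ ->]]; last exact: al_pow_neq0.
have k1 : k ^+ p.-1 = 1.
  apply: (mulfI k0); rewrite mulr1 -exprS prednK ?prime_gt0 //.
  by have := expf_card k; rewrite card_Fp.
by have [j ->] := prim_rootP a_prim k1; exists j; rewrite ?mem_index_enum.
Qed.

Hypotheses (tau_p1 : (tau ^+ p.-1 = 1)%g) (sigma_p : (sigma ^+ p = 1)%g).
Hypothesis nform_bij : bijective (@normal_form p gT sigma tau).
Hypothesis conj_rel : (tau * sigma * tau^-1 = sigma ^+ a)%g.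
Hypothesis sigma_neq_tau : sigma != tau.
Local Notation X := (cayley [set sigma; tau]).

(** Each vertex has exactly two outgoing edges, because the generators
    differ. *)
Lemma sum_cayley (M : nmodType) (f : gT -> M) (g : gT) :
  \sum_(e : edge X | org e == g) f (ter e) = f (g * sigma)%g + f (g * tau)%g.
Proof.
have hs : (g, sigma).2 \in [set sigma; tau] by rewrite !inE eqxx.
have ht : (g, tau).2 \in [set sigma; tau] by rewrite !inE eqxx orbT.
rewrite (bigD1 (Sub (g, sigma) hs : edge X)) //= (bigD1 (Sub (g, tau) ht : edge X)) /=.
  rewrite big1 ?addr0 // => -[[x s] hxs] /=; rewrite -!val_eqE /= !xpair_eqE.
  case/andP=> /andP[/eqP -> ]; rewrite eqxx /= => /negPf ns /negPf nt.
  by move: hxs; rewrite !inE /= ns nt.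
by rewrite eqxx -val_eqE /= xpair_eqE eqxx eq_sym.
Qed.

(** The exponent of tau ranges over nat here, so that walking along tau does
    not have to be reduced modulo p - 1 at each step. *)
Definition sigtau (i : 'F_p) (j : nat) : gT := (sigma ^+ i * tau ^+ j)%g.

Lemma sigtau_sigma i j : (sigtau i j * sigma = sigtau (i + al ^+ j)%R j)%g.
Proof.
rewrite /sigtau -mulgA (tauX_sigma p_pr sigma_p conj_rel) mulgA.
by rewrite -(sigmaD p_pr sigma_p).
Qed.
Lemma sigtau_tau i j : (sigtau i j * tau = sigtau i j.+1)%g.
Proof. by rewrite /sigtau -mulgA -expgSr. Qed.
Lemma sigtau_period i : sigtau i p.-1 = sigtau i 0.
Proof. by rewrite /sigtau tau_p1 expg0. Qed.

Variables (R : comNzRingType) (th u eps : R) (P : lmodType R) (w : gT -> P).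
Local Notation RC := (grpring R 'F_p).
Hypotheses (uth : u * th = 1) (epsP : eps * ((u - 1) ^+ p.-1 - 1) = 1).

(** The factors of the norm, in the order in which they are met when
    multiplying by tau. *)
Definition partial_norm j : RC :=
  \prod_(l < j) (gsingle 0 u - gsingle (al ^+ l) 1).
(** With u the inverse of theta this is u (u^(p-1) - 1)/(u - 1), the common
    annihilator of the basis constructed below. *)
Definition annih : R := \sum_(i < p) u ^+ i - 1.
Local Notation beta := (gnorm p u 1).
Local Notation S i := (gsingle i 1 : RC).

Lemma partial_normS j :
  partial_norm j.+1 = partial_norm j * (gsingle 0 u - S (al ^+ j)).
Proof. by rewrite /partial_norm big_ord_recr. Qed.

Lemma partial_norm_full i :
  S i * partial_norm p.-1 = S i + (gsingle i annih + [ffun=> beta]).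
Proof.
have -> : partial_norm p.-1 = gnorm p u by rewrite /gnorm big_Fp_unit.
rewrite [in LHS]gnormE // mulrDr gsingleM addr0 mul1r addrA; congr (_ + _).
  by apply/ffunP => k; rewrite !ffunE; case: eqP; rewrite ?addr0 // addrC subrK.
by apply/ffunP => k; rewrite gsingle_shift !ffunE.
Qed.

Lemma annih_beta : annih + p%:R * beta = (u - 1) ^+ p.-1 - 1.
Proof. by rewrite -(gnorm_aug p_pr) addrAC. Qed.

Section Generators.
Hypothesis wrel : forall g, w g = th *: (w (g * sigma)%g + w (g * tau)%g).
Hypothesis wspan : forall x, exists c : gT -> R, x = \sum_g c g *: w g.

Definition wF (x : RC) : P := \sum_k x k *: w (sigtau k 0).
Definition zgen (k : 'I_p.-1) : P := w (sigtau (al ^+ k) 0) - w (sigtau 0 0).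

Fact wF_is_zmod_morphism : zmod_morphism wF.
Proof.
move=> x y; rewrite /wF -sumrB; apply: eq_bigr => k _.
by rewrite !ffunE scalerBl.
Qed.
HB.instance Definition _ := GRing.isZmodMorphism.Build RC P wF wF_is_zmod_morphism.

Lemma wFZ c x : wF (gsingle 0 c * x) = c *: wF x.
Proof.
by rewrite scaler_sumr; apply: eq_bigr => k _; rewrite gsingle0M scalerA.
Qed.

Lemma wF_single i c : wF (gsingle i c) = c *: w (sigtau i 0).
Proof.
rewrite /wF (bigD1 i) //= ffunE eqxx big1 ?addr0 // => k /negPf ki.
by rewrite ffunE ki scale0r.
Qed.

(** By the relation at g, w_(g tau) = u w_g - w_(g sigma), and moving sigma to
    the left of tau^j turns it into sigma^(a^j). *)
Lemma w_sigtau i j : w (sigtau i j) = wF (S i * partial_norm j).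
Proof.
elim: j i => [|j IH] i; first by rewrite /partial_norm big_ord0 mulr1 wF_single scale1r.
have -> : w (sigtau i j.+1) = u *: w (sigtau i j) - w (sigtau (i + al ^+ j) j).
  by rewrite (wrel (sigtau i j)) scalerA uth scale1r
    sigtau_sigma sigtau_tau [RHS]addrC addKr.
rewrite !IH partial_normS mulrBr mulrBr raddfB /= -wFZ; congr (wF _ - wF _).
  by rewrite mulrCA (mulrC _ (partial_norm j)).
by rewrite -[in LHS](mulr1 (1 : R)) -gsingleM mulrAC -mulrA.
Qed.

(** Going once around the powers of tau returns to the start, so the norm acts
    as the identity; the norm is explicit by [gnormE]. *)
Lemma w_annih i : annih *: w (sigtau i 0) = - (beta *: \sum_k w (sigtau k 0)).
Proof.
have := w_sigtau i p.-1.
rewrite sigtau_period partial_norm_full !raddfD /= !wF_single scale1r.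
rewrite -[LHS]addr0 => /addrI/esym/eqP; rewrite addr_eq0 => /eqP ->; congr (- _).
by rewrite scaler_sumr; apply: eq_bigr => k _; rewrite ffunE.
Qed.

Lemma zgen_annih k : annih *: zgen k = 0.
Proof. by rewrite scalerBr !w_annih subrr. Qed.

(** In [w_annih] at 0, writing each w_(sigma^k) as the sum of w_1 and z_k
    collects the factor annih + p beta, which is the unit (u - 1)^(p-1) - 1
    inverted by eps. *)
Lemma w_one : w (sigtau 0 0) = - (eps * beta) *: \sum_k zgen k.
Proof.
have sumw : \sum_k w (sigtau k 0) = p%:R *: w (sigtau 0 0) + \sum_k zgen k.
  rewrite (bigD1 0) //= big_Fp_unit.
  have -> : \sum_k zgen k =
      \sum_(j < p.-1) w (sigtau (al ^+ j) 0) - w (sigtau 0 0) *+ p.-1.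
    by rewrite sumrB sumr_const card_ord.
  have -> (x : P) : p%:R *: x = x + x *+ p.-1.
    by rewrite scaler_nat -mulrS prednK ?prime_gt0.
  by rewrite -addrA [X in _ = _ + X]addrC subrK.
have := w_annih 0; rewrite sumw scalerDr opprD scalerA => /eqP.
rewrite addrC -subr_eq opprK -scalerDl (mulrC beta) annih_beta => /eqP e.
by rewrite -[LHS]scale1r -epsP -scalerA e scalerN scalerA scaleNr.
Qed.

Lemma zgen_span x : exists c, x = \sum_k c k *: zgen k.
Proof.
pose S (x : P) := exists c, x = \sum_k c k *: zgen k.
have SD x1 x2 : S x1 -> S x2 -> S (x1 + x2).
  move=> [c1 ->] [c2 ->]; exists (fun k => c1 k + c2 k).
  by rewrite -big_split; apply: eq_bigr => k _; rewrite scalerDl.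
have SZ c x1 : S x1 -> S (c *: x1).
  move=> [c1 ->]; exists (fun k => c * c1 k).
  by rewrite scaler_sumr; apply: eq_bigr => k _; rewrite scalerA.
have S0 : S 0 by exists (fun=> 0); rewrite big1 // => k _; rewrite scale0r.
have Ssum (I : finType) (F : I -> P) : (forall i, S (F i)) -> S (\sum_i F i).
  by move=> SF; elim/big_ind: _.
have Sz k : S (zgen k).
  exists (fun l => (l == k)%:R); rewrite (bigD1 k) //= eqxx scale1r.
  by rewrite big1 ?addr0 // => l /negPf ->; rewrite scale0r.
have Sw0 : S (w (sigtau 0 0)) by rewrite w_one; apply/SZ/Ssum.
have Sw k : S (w (sigtau k 0)).
  have [->//|k0] := eqVneq k 0.
  have [j ->] : exists j : 'I_p.-1, k = al ^+ j.
    have := @big_Fp_unit bool false orb (fun l => l == k).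
    rewrite (bigD1 k) //= eqxx orTb => /esym.
    by rewrite big_orE => /existsP[j /eqP <-]; exists j.
  by rewrite -[w _](subrK (w (sigtau 0 0))); apply: SD => //; apply: (Sz j).
have [c ->] := wspan x; apply: (Ssum) => g; apply: (SZ).
have [inv _ invK] := nform_bij; rewrite -(invK g).
rewrite -[normal_form _ _ _]/(sigtau (inv g).1 (inv g).2) w_sigtau.
by apply: (Ssum) => k; apply: SZ.
Qed.

Hypothesis wker : forall c : gT -> R, \sum_g c g *: w g = 0 ->
  exists d : vert X -> R, forall g, c g = relcomb th d g.

(** The coordinates with respect to the z_k extend to a function lam on G that
    satisfies the relations of the module up to multiples of annih. Pairing lam
    with a relation among the z_k then isolates each coefficient modulo annih.
 *)
Lemma zgen_kernel (c : 'I_p.-1 -> R) :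
  \sum_k c k *: zgen k = 0 -> forall k, exists e, c k = e * annih.
Proof.
move=> cz0 m.
have [inv invK Kinv] := nform_bij; have n_gt0 := prim_order_gt0 a_prim.
(* The form ell is the coordinate along z_m of an element of the group ring of
   the cyclic group, once the group element 1 has been eliminated by [w_one];
   kap maps G to this group ring through normal forms. *)
pose r := eps * beta; pose am := al ^+ m : 'F_p.
pose ell (x : RC) : R := x am - r * \sum_k x k.
pose kap (g : gT) : RC := S (inv g).1 * partial_norm (inv g).2.
have kapE i (j : 'I_p.-1) : kap (sigtau i j) = S i * partial_norm j.
  by rewrite /kap -[sigtau i j]/(normal_form sigma tau (i, j)) invK.
have kap0 i : kap (sigtau i 0) = S i.
  by rewrite (kapE i (Ordinal n_gt0)) /partial_norm big_ord0 mulr1.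
have ellB x y : ell (x - y) = ell x - ell y.
  rewrite /ell !ffunE (eq_bigr (fun k => x k - y k)) => [|k _].
    by rewrite sumrB; ring.
  by rewrite !ffunE.
have ellD x y : ell (x + y) = ell x + ell y.
  by rewrite -[x in RHS](addrK y) ellB subrK.
have ellZ b x : ell (gsingle 0 b * x) = b * ell x.
  rewrite /ell gsingle0M (eq_bigr (fun k => b * x k)) => [|k _].
    by rewrite -mulr_sumr mulrBr mulrCA.
  by rewrite gsingle0M.
have ell_single i b : ell (gsingle i b) = (if am == i then b else 0) - r * b.
  rewrite /ell ffunE (bigD1 i) //= ffunE eqxx big1 ?addr0 // => k /negPf ki.
  by rewrite ffunE ki.
have ell_const b : ell [ffun => b] = b - r * (p%:R * b).
  rewrite /ell ffunE (eq_bigr (fun=> b)) => [|k _]; last by rewrite ffunE.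
  by rewrite sumr_const card_Fp // mulr_natl.
have lam_rel g : exists b,
    ell (kap g) - th * (ell (kap (g * sigma)%g) + ell (kap (g * tau)%g)) = b * annih.
  rewrite -(Kinv g); case: (inv g) => i j.
  rewrite -[normal_form _ _ _]/(sigtau i j) sigtau_sigma sigtau_tau.
  rewrite -!ellD -ellZ -ellB !kapE.
  have -> : S i * partial_norm j -
      gsingle 0 th * (S (i + al ^+ j) * partial_norm j + kap (sigtau i j.+1)) =
      gsingle 0 th * (S i * partial_norm j.+1 - kap (sigtau i j.+1)).
    have thu : gsingle 0 th * gsingle 0 u = 1 :> RC.
      by rewrite gsingleM addr0 mulrC uth.
    have -> : S (i + al ^+ j) = S i * S (al ^+ j) by rewrite gsingleM mulr1.
    rewrite partial_normS -[X in X - _]mul1r -thu; ring.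
  (* The relation at g holds exactly, except where the power of tau wraps
     around; there it fails by the difference of the norm and 1, which ell maps
     to a multiple of annih. *)
  have [jn|jn] := ltnP j.+1 p.-1.
    exists 0; rewrite -[j.+1]/(val (Ordinal jn)) kapE subrr ellZ mul0r.
    by rewrite -(subrr 0) ellB subrr mulr0.
  have -> : j.+1 = p.-1 by apply/eqP; rewrite eqn_leq ltn_ord.
  rewrite sigtau_period kap0 partial_norm_full addrC addKr.
  rewrite ellZ ellD ell_single ell_const.
  exists (th * (am == i)%:R).
  have rE : r * (annih + p%:R * beta) = beta.
    by rewrite annih_beta /r mulrAC epsP mul1r.
  have -> : beta - r * (p%:R * beta) = r * annih.
    by rewrite -[X in X - _]rE mulrDr addrK.
  by rewrite subrK -mulrA; case: eqP; rewrite ?mul1r ?mul0r.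
have am0 : (am == 0) = false := negPf (al_pow_neq0 m).
pose lam g : R^o := ell (kap g).
(* The coefficients, in terms of the generators w_g, of the given combination
   of the z_k. *)
pose C g : R := \sum_k c k * ((g == sigtau (al ^+ k) 0)%:R - (g == sigtau 0 0)%:R).
have CE (M : lmodType R) (f : gT -> M) :
    \sum_g C g *: f g = \sum_k c k *: (f (sigtau (al ^+ k) 0) - f (sigtau 0 0)).
  have delta x : \sum_g (g == x)%:R *: f g = f x.
    rewrite (bigD1 x) //= eqxx scale1r big1 ?addr0 // => g /negPf ->.
    by rewrite scale0r.
  under eq_bigr => g _ do rewrite scaler_suml.
  rewrite exchange_big; apply: eq_bigr => k _.
  under eq_bigr => g _ do rewrite -scalerA scalerBl.
  by rewrite -scaler_sumr sumrB !delta.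
have [|d dE] := wker (c := C); first by rewrite CE.
have lam0 i : lam (sigtau i 0) = (am == i)%:R - r.
  by rewrite /lam kap0 ell_single mulr1; case: eqP.
have := CE _ lam; under eq_bigr => g _ do rewrite dE.
rewrite (@sum_relcomb X) (bigD1 m) //= !lam0 eqxx am0.
rewrite [X in _ = _ + X]big1 => [|k km]; last first.
  by rewrite !lam0 (inj_eq (prim_pow_inj a_prim)) eq_sym (negPf km) subrr scaler0.
rewrite addr0 sub0r opprK subrK => e.
have -> : c m = \sum_g d g * (lam g - th * (lam (g * sigma)%g + lam (g * tau)%g)).
  rewrite -[LHS]mulr1 -[LHS]e; apply: eq_bigr => g _.
  by rewrite sum_cayley.
have /choice[b bE] g := lam_rel g.
exists (\sum_g d g * b g); rewrite mulr_suml; apply: eq_bigr => g _.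
by rewrite bE mulrA.
Qed.

Lemma zgen_kernelP (c : 'I_p.-1 -> R) :
  \sum_k c k *: zgen k = 0 <-> forall k, exists e, c k = e * annih.
Proof.
split; first exact: zgen_kernel.
move=> hc; rewrite big1 // => k _; have [e ->] := hc k.
by rewrite -scalerA zgen_annih scaler0.
Qed.
End Generators.
End Structure.

(** * Elementary modules *)

Section ElementaryModules.
Local Open Scope quotient_scope.

Section CyclicSum.
Variable R : comNzRingType.

Lemma cyc_pi_eq0 (d x : R) : \pi_(cyc d) x = 0 <-> exists e, x = e * d.
Proof.
rewrite -(raddf0 (\pi_(cyc d))); split=> [/eqP|[e ex]].
  by rewrite -Quotient.idealrBE subr0 => /asboolP.
by apply/eqP; rewrite -Quotient.idealrBE subr0; apply/asboolP; exists e.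
Qed.

(** Coefficients are taken from a function on nat rather than from a tuple, so
    that the recursion only shifts indices. *)
Fixpoint cyc_map (ds : seq R) (c : nat -> R) : cyc_sum ds :=
  if ds is d :: ds' then (\pi_(cyc d) (c 0%N), cyc_map ds' (fun i => c i.+1))
  else 0.

Lemma cyc_map_lin ds (k : R) c c' :
  cyc_map ds (fun i => k * c i + c' i) = k *: cyc_map ds c + cyc_map ds c'.
Proof.
elim: ds c c' => [|d ds IH] c c' /=; first by rewrite scaler0 addr0.
rewrite IH raddfD; congr (_, _); congr (_ + _).
by rewrite [RHS]cyc_scale_pi.
Qed.

Lemma cyc_map_eq0 ds c : cyc_map ds c = 0 <->
  forall i, (i < size ds)%N -> exists e, c i = e * ds`_i.
Proof.
elim: ds c => [|d ds IH] c //=; split.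
  by case=> /cyc_pi_eq0 h0 /IH hS [|i] // /hS.
move=> h; congr (_, _); first by apply/cyc_pi_eq0; apply: (h 0%N).
by apply/IH => i; apply: (h i.+1).
Qed.

Lemma cyc_map_surj ds (y : cyc_sum ds) : exists c, cyc_map ds c = y.
Proof.
elim: ds y => [|d ds IH] /= y; first by exists (fun=> 0); apply/rowP => -[].
case: y => y1 y2; have [c <-] := IH y2; elim/quotW: y1 => y1.
by exists (fun i => if i is i'.+1 then c i' else y1).
Qed.

(** Generators whose relations are exactly the divisibilities by the ds
    identify M with the elementary module: the image of x is read off any of
    its expressions. *)
Lemma cyc_sum_iso (M : lmodType R) (ds : seq R) (z : nat -> M) :
    (forall x, exists c, x = \sum_(i < size ds) c (i : nat) *: z i) ->
    (forall c, \sum_(i < size ds) c (i : nat) *: z i = 0 <->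
       forall i, (i < size ds)%N -> exists e, c i = e * ds`_i) ->
  exists phi : {linear M -> cyc_sum ds},
    injective phi /\ forall y, exists x, phi x = y.
Proof.
move=> span ker; pose comb c : M := \sum_(i < size ds) c (i : nat) *: z i.
have combL k c c' : comb (fun i => k * c i + c' i) = k *: comb c + comb c'.
  rewrite scaler_sumr -big_split; apply: eq_bigr => i _.
  by rewrite scalerDl scalerA.
have map_comb c c' : cyc_map ds c = cyc_map ds c' <-> comb c = comb c'.
  pose d i := -1 * c' i + c i.
  have -> : cyc_map ds c = cyc_map ds c' <-> cyc_map ds d = 0.
    rewrite cyc_map_lin scaleN1r addrC; split=> [->|/eqP]; first exact: subrr.
    by rewrite subr_eq0 => /eqP.
  rewrite cyc_map_eq0 -ker -/(comb d) combL scaleN1r addrC.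
  by split=> [/eqP|->]; [rewrite subr_eq0 => /eqP | exact: subrr].
have /choice[co coE] := span.
pose phi x := cyc_map ds (co x).
have phiL : linear phi.
  move=> k x y; rewrite /phi -cyc_map_lin; apply/map_comb.
  by rewrite combL /comb -!coE.
exists (HB.pack_for {linear M -> cyc_sum ds} phi
  (GRing.isLinear.Build R M (cyc_sum ds) *:%R phi phiL)); split=> [x y|y].
  by move/map_comb; rewrite /comb -!coE.
have [c <-] := cyc_map_surj y; exists (comb c); apply/map_comb.
by rewrite /comb -coE.
Qed.
End CyclicSum.

Lemma bijective_pseudo_iso (R : pzRingType) (M N : lmodType R)
    (f : {linear M -> N}) :
  injective f -> (forall y, exists x, f x = y) -> pseudo_iso f.
Proof.
move=> finj fsurj; split.
  apply: (sub_finite_set (B := [set 0]%classic)); last exact: finite_set1.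
  by move=> x /= fx0; apply: finj; rewrite fx0 raddf0.
apply: (sub_finite_set (B := [set \pi_(coker f) 0]%classic)); last exact: finite_set1.
move=> y _; elim/quotW: y => y /=; apply/eqP; rewrite -Quotient.idealrBE subr0.
by apply/asboolP; have [x <-] := fsurj y; exists x.
Qed.
End ElementaryModules.

(** * The distinguished polynomial ((1 + T)^Q - 1)/T *)

Section LambdaConst.
Variable q : nat.
Fact Lambda_const_is_zmod_morphism : zmod_morphism (@Lambda_const q).
Proof.
by move=> x y; apply: ringlim_ext => m; apply: (raddfB (gsingle (0 : Gam q m))).
Qed.
Fact Lambda_const_is_monoid_morphism : monoid_morphism (@Lambda_const q).
Proof.
split=> [|x y]; apply: ringlim_ext => m //.
exact: (rmorphM (gsingle (0 : Gam q m))).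
Qed.
HB.instance Definition _ := GRing.isZmodMorphism.Build _ _ (@Lambda_const q)
  Lambda_const_is_zmod_morphism.
HB.instance Definition _ := GRing.isMonoidMorphism.Build _ _ (@Lambda_const q)
  Lambda_const_is_monoid_morphism.

Definition theta_inv_val m : grpring (Zq q) (Gam q m) := gsingle (- theta_ q m) 1.
Fact theta_invP m : ringsys_tr (Lambda_sys q) m (theta_inv_val m.+1) = theta_inv_val m.
Proof. by rewrite /= gpush_single raddfN /= Gam_proj_theta. Qed.
Definition theta_inv : Lambda q := @RingLim (Lambda_sys q) _ theta_invP.

Lemma theta_invM : theta_inv * theta q = 1.
Proof. by apply: ringlim_ext => m; rewrite /= gsingleM addNr mulr1. Qed.
End LambdaConst.

Section Geometric.
Variable R : comNzRingType.
Implicit Types u th : R.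

Lemma geom_mul u m n :
  \sum_(i < m * n) u ^+ i = (\sum_(i < m) u ^+ i) * \sum_(j < n) u ^+ (m * j).
Proof.
elim: n => [|n IH]; first by rewrite muln0 !big_ord0 mulr0.
rewrite mulnSr big_split_ord /= IH [in RHS]big_ord_recr mulrDr /=; congr (_ + _).
by rewrite mulr_suml; apply: eq_bigr => i _; rewrite exprD mulrC.
Qed.

(** Reversing the order of summation. *)
Lemma geom_inv u th n : u * th = 1 ->
  (\sum_(i < n) u ^+ i) * th ^+ n = th * \sum_(i < n) th ^+ i.
Proof.
move=> uth; rewrite (reindex_inj rev_ord_inj) mulr_suml mulr_sumr.
apply: eq_bigr => i _ /=; rewrite -[in th ^+ n](subnK (ltn_ord i)) exprD mulrA.
by rewrite -exprMn uth expr1n mul1r exprS.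
Qed.
End Geometric.

Section Distinguished.
Variables (q v : nat).
Hypothesis q_pr : prime q.
Local Notation Q := (q ^ v)%N.
Let Q_gt0 : (0 < Q)%N. Proof. by rewrite expn_gt0 prime_gt0. Qed.

(** This is ((1 + T)^Q - 1)/T, written as a geometric sum to avoid the
    division. *)
Definition geom_poly : {poly Zq q} := \sum_(i < Q) ('X + 1) ^+ i.

Lemma geom_poly_mulX : geom_poly * 'X = ('X + 1) ^+ Q - 1.
Proof. by rewrite subrX1 addrK mulrC. Qed.

Let X1 : 'X + 1 = 'X - (-1)%:P :> {poly Zq q}.
Proof. by rewrite polyCN opprK. Qed.

Let sizeXQ : size (('X + 1) ^+ Q : {poly Zq q}) = Q.+1.
Proof. by rewrite X1 size_exp_XsubC. Qed.

Let size1Q : (size (- 1 : {poly Zq q})%R < size (('X + 1) ^+ Q : {poly Zq q}))%N.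
Proof. by rewrite size_polyN size_poly1 sizeXQ. Qed.

Lemma geom_poly_monic : geom_poly \is monic.
Proof.
rewrite monicE -lead_coefMX geom_poly_mulX lead_coefDl // X1.
by rewrite -monicE monic_exp // monicXsubC.
Qed.

Lemma size_geom_poly : size geom_poly = Q.
Proof.
have := size_mulX (monic_neq0 geom_poly_monic).
by rewrite geom_poly_mulX size_polyDl // sizeXQ => -[].
Qed.

(** Multiplied by T, the polynomial is T^Q modulo q. *)
Lemma geom_poly_distinguished : distinguished geom_poly.
Proof.
split=> [|i]; first exact: geom_poly_monic.
rewrite size_geom_poly -ltnS prednK // => iQ.
have [z zE] := frobenius_iter q_pr v ('X : {poly Zq q}) 1.
exists z`_i.+1; have := congr1 (fun P : {poly Zq q} => P`_i.+1) geom_poly_mulX.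
rewrite coefMX /= => ->; rewrite zE expr1n addrAC addrK coefD coefXn.
by rewrite ltn_eqF // add0r mulr_natl coefMn mulr_natl.
Qed.

Lemma at_geom_poly : at_T geom_poly = \sum_(i < Q) theta q ^+ i.
Proof.
pose F : {rmorphism {poly Zq q} -> Lambda q} :=
  horner_eval (theta q - 1) \o map_poly (@Lambda_const q).
rewrite -[LHS]/(F geom_poly) rmorph_sum; apply: eq_bigr => i _.
rewrite rmorphXn rmorphD rmorph1 /= map_polyX /horner_eval hornerX.
by rewrite subrK.
Qed.

(** At level 0 theta is 1, and the value Q is not zero modulo q Q. *)
Lemma at_geom_poly_neq0 : at_T geom_poly != 0.
Proof.
apply/eqP; rewrite at_geom_poly => /(congr1 (rproj 0%N)).
have th0 : rproj 0%N (theta q) = 1.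
  rewrite /rproj /=; have -> : theta_ q 0 = 0 by apply: val_inj.
  exact: gsingle1.
rewrite raddf0 rmorph_sum (eq_bigr (fun=> 1)) => [|i _]; last first.
  by transitivity (rproj 0%N (theta q) ^+ i); [apply: rmorphXn | rewrite th0 expr1n].
rewrite sumr_const card_ord -(rmorph_nat (gsingle (0 : Gam q 0))).
move/ffunP/(_ 0); rewrite !ffunE eqxx => /(congr1 (rproj v)).
rewrite raddf0 rmorph_nat => /(congr1 val).
have qv : (1 < q ^ v.+1)%N.
  apply: (leq_trans (prime_gt1 q_pr)).
  by rewrite expnS leq_pmulr // expn_gt0 prime_gt0.
rewrite /= val_Zp_nat // modn_small ?ltn_exp2l ?prime_gt1 //.
by move=> e; move: Q_gt0; rewrite e.
Qed.

(** Write p - 1 = Q n' with n' prime to q. The geometric sum of length p - 1 in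
    u is that of length Q in u times that of length n' in u^Q; the latter is n'
    modulo theta - 1, hence a unit, and the former is the geometric sum in
    theta up to a power of theta. *)
Lemma annih_assoc (p : nat) : prime p -> v = logn q p.-1 -> (1 < p)%N ->
  exists x y : Lambda q, annih p (theta_inv q) = x * at_T geom_poly /\
                         at_T geom_poly = y * annih p (theta_inv q).
Proof.
move=> p_pr vE p_gt1; set u := theta_inv q; set th := theta q.
have uth : u * th = 1 := theta_invM q.
have n_gt0 : (0 < p.-1)%N by rewrite -ltnS prednK // ltnW.
have [n' qn' nE] := pfactor_coprime q_pr n_gt0; rewrite -vE in nE.
have hE : annih p u = u * \sum_(i < p.-1) u ^+ i.
  rewrite /annih -(prednK (prime_gt0 p_pr)) /= big_ord_recl expr0 addrC addKr.
  by rewrite mulr_sumr; apply: eq_bigr => i _; rewrite -exprS.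
have u1 : u - 1 = (th - 1) * - u.
  by rewrite mulrN mulrBl mul1r mulrC uth opprB.
have [y yE] : exists y, \sum_(j < n') u ^+ (Q * j) = n'%:R + (th - 1) * y.
  exists (\sum_(j < n') - u * \sum_(i < Q * j) u ^+ i).
  rewrite mulr_sumr -[n' in n'%:R]card_ord -sumr_const -big_split /=.
  by apply: eq_bigr => j _; rewrite mulrA -u1 -subrX1 addrC subrK.
have [e eW] := Lambda_unit q_pr y qn'.
rewrite hE nE mulnC geom_mul yE at_geom_poly.
have gi := geom_inv Q uth; set Su := \sum_(i < Q) u ^+ i; set W := (n'%:R + _).
exists (u * W * u ^+ Q * th), (u * e * th ^+ Q * th); split.
  rewrite -[RHS]mulrA -gi -/Su -[u ^+ Q]/(u ^+ Q).
  transitivity (u * (Su * W) * (u * th) ^+ Q); first by rewrite uth expr1n mulr1.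
  by rewrite exprMn; ring.
transitivity (u * (th * \sum_(i < Q) th ^+ i)); first by rewrite mulrA uth mul1r.
rewrite -gi -/Su.
transitivity (u * (Su * th ^+ Q) * (e * W) * (u * th)).
  by rewrite uth eW !mulr1.
by ring.
Qed.

Lemma augmentation_unit (n : nat) : (0 < n)%N ->
  exists eps : Lambda q, eps * ((theta_inv q - 1) ^+ n - 1) = 1.
Proof.
move=> n_gt0; set u := theta_inv q; set th := theta q.
have u1 : u - 1 = (th - 1) * - u.
  by rewrite mulrN mulrBl mul1r mulrC theta_invM opprB.
pose y := u * (u - 1) ^+ n.-1.
have [e eW] := Lambda_unit q_pr (c := 1) y (coprimen1 q).
exists (- e); rewrite -{1}(prednK n_gt0) exprS u1 -[RHS]eW /y -/th u1; ring.
Qed.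
End Distinguished.

(** * Iwasawa invariants of the tower *)

(** A basis annihilated exactly by an associate of f(T) gives an isomorphism
    with a sum of copies of Lambda/(f). *)
Lemma iwasawa_of_basis (q : nat) (M : lmodType (Lambda q)) (n : nat)
    (f : {poly Zq q}) (h : Lambda q) (z : 'I_n -> M) :
  distinguished f -> at_T f != 0 ->
  (exists x y, h = x * at_T f /\ at_T f = y * h) ->
  (forall x, exists c, x = \sum_k c k *: z k) ->
  (forall c, \sum_k c k *: z k = 0 <-> forall k, exists e, c k = e * h) ->
  iwasawa_invariants M 0 (n * (size f).-1)%N.
Proof.
move=> f_dist f_neq0 [x [y [hE fE]]] zspan zker.
split; first by exists n, z.
  move=> m; exists (at_T f) => //; have [c ->] := zspan m.
  rewrite scaler_sumr (eq_bigr (fun k => (at_T f * c k) *: z k)) => [|k _].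
    by apply/zker => k; exists (c k * y); rewrite -mulrA -fE mulrC.
  by rewrite scalerA.
pose z' i := if insub i is Some k then z k else 0.
have z'E (k : 'I_n) : z' k = z k by rewrite /z' valK.
pose ds := [seq at_T g | g <- nseq n f].
have dsn : size ds = n by rewrite size_map size_nseq.
have sumE (c : nat -> Lambda q) :
    \sum_(i < size ds) c i *: z' i = \sum_(k < n) c k *: z k.
  by rewrite dsn; apply: eq_bigr => k _; rewrite z'E.
have [m|c|phi [phi_inj phi_surj]] := @cyc_sum_iso _ M ds z'.
- have [c ->] := zspan m.
  pose c' i := if insub i is Some k then c k else 0; exists c'.
  by rewrite (sumE c'); apply: eq_bigr => k _; rewrite /c' valK.
- rewrite sumE zker dsn; split=> [hc i ilt|hc k].
    have [e eE] := hc (Ordinal ilt); exists (e * x); rewrite -[c i]/(c (Ordinal ilt)).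
    by rewrite eE (nth_map 0) ?size_nseq // nth_nseq ilt hE mulrA.
  have [e ->] := hc k (ltn_ord k); exists (e * y).
  by rewrite (nth_map 0) ?size_nseq // nth_nseq ltn_ord -mulrA -fE.
exists [::], (nseq n f), phi; split=> //.
- by move=> g /nseqP[->].
- exact: bijective_pseudo_iso.
by rewrite map_nseq sumn_nseq mulnC.
Qed.

Section BFInvariants.
Variables (p a : nat) (gT : finGroupType) (sigma tau : gT).
Hypotheses (p_pr : prime p) (p_gt2 : (2 < p)%N).
Hypothesis a_prim : p.-1.-primitive_root (a%:R : 'F_p).
Hypothesis G_pres : ([set: gT] \isog
     Grp (s : t : (s ^+ p, t ^+ p.-1, t * s * t^-1 = s ^+ a)))%g.
Hypotheses (G_gen : [set: gT] = <<[set sigma; tau]>>%g)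
  (sigma_p : (sigma ^+ p = 1)%g) (tau_p1 : (tau ^+ p.-1 = 1)%g)
  (conj_rel : (tau * sigma * tau^-1 = sigma ^+ a)%g).

Lemma BF_invariants q : prime q ->
  iwasawa_invariants (BF_inf q (cayley [set sigma; tau])) 0
    (p.-1 * (q ^ logn q p.-1 - 1)).
Proof.
move=> q_pr; set X := cayley _; set v := logn q p.-1.
have n_gt0 : (0 < p.-1)%N by rewrite -ltnS prednK ?prime_gt0 // ltnW.
have st : sigma != tau by apply: sigma_neq_tau G_gen sigma_p tau_p1 conj_rel.
have nfb : bijective (@normal_form p gT sigma tau).
  by apply: normal_form_bij G_gen sigma_p tau_p1 conj_rel.
have [eps epsP] := augmentation_unit q_pr n_gt0.
pose w : gT -> BF_inf q X := @bfgen q X.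
have wrel g : w g = theta q *: (w (g * sigma)%g + w (g * tau)%g).
  by rewrite -(sum_cayley st) /w bfgen_rel.
rewrite subn1 -(size_geom_poly v q_pr).
apply: (@iwasawa_of_basis q _ _ _ _ (zgen a sigma tau w)).
- exact: geom_poly_distinguished.
- exact: at_geom_poly_neq0.
- exact: annih_assoc (ltnW p_gt2).
- exact: (zgen_span p_pr a_prim tau_p1 sigma_p nfb conj_rel
    (theta_invM q) epsP wrel (@bfgen_span q X)).
- exact: (zgen_kernelP p_pr a_prim tau_p1 sigma_p nfb conj_rel st
    (theta_invM q) epsP wrel (@bfgen_kernel q X)).
Qed.
End BFInvariants.

(** * Diagonalizable matrices from representations of the metacyclic group *)

Section Diagonalizable.
Variable F : fieldType.

Lemma rank_diag_mx n (d : 'rV[F]_n) : \rank (diag_mx d) = #|[pred i | d 0 i != 0]|.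
Proof.
elim: n d => [|n IH] d; first by rewrite flatmx0 mxrank0 eq_card0 // => -[].
pose d1 : 'rV[F]_(1 + n) := d.
transitivity (\rank (diag_mx (row_mx (lsubmx d1) (rsubmx d1)))).
  by rewrite hsubmxK.
rewrite diag_mx_row rank_diag_block_mx IH.
have -> : diag_mx (lsubmx d1) = (d 0 0)%:M.
  apply/matrixP => i j; rewrite !ord1 !mxE eqxx !mulr1n; congr (d _ _).
  exact: val_inj.
rewrite -[in RHS]sum1_card [RHS]big_mkcond big_ord_recl -big_mkcond /= -sum1_card.
congr (_ + _)%N.
  rewrite inE; case: eqVneq => [->|d0]; first by rewrite raddf0 mxrank0.
  by rewrite mxrank_unit // unitmxE det_scalar expr1 unitfE.
apply: eq_bigl => i; rewrite !inE mxE; congr (d 0 _ != 0).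
exact: val_inj.
Qed.

(** Both multiplicities are invariant under conjugation and count the diagonal
    entries equal to c for a diagonal matrix. *)
Lemma diagonalizable_mult n (A : 'M[F]_n) (c : F) :
  diagonalizable A -> mup c (char_poly A) = \rank (eigenspace A c).
Proof.
case=> P Pu /diagonalizable_forPex[d /(simmxP Pu) PA].
have charE : char_poly A = \prod_(i < n) ('X - (d 0 i)%:P).
  transitivity (char_poly (diag_mx d)).
    have detP : \det (map_mx polyC P) != 0.
      by rewrite det_map_mx polyC_eq0 -unitfE -unitmxE.
    apply: (mulfI detP); rewrite -det_mulmx [RHS]mulrC -det_mulmx; congr (\det _).
    rewrite /char_poly_mx mulmxBr mulmxBl -!map_mxM PA; congr (_ - _).
    by rewrite mul_mx_scalar mul_scalar_mx.
  rewrite char_poly_trig ?is_diag_mx_is_trig ?diag_mx_is_diag //.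
  by apply: eq_bigr => i _; rewrite mxE eqxx.
have rankE : \rank (A - c%:M) = \rank (diag_mx d - c%:M).
  transitivity (\rank (P *m (A - c%:M))).
    by rewrite eqmxMfull // row_full_unit.
  rewrite mulmxBr PA mul_mx_scalar -mul_scalar_mx -mulmxBl.
  by rewrite mxrankMfree // row_free_unit.
rewrite /eigenspace mxrank_ker rankE -diag_const_mx -linearB rank_diag_mx charE.
rewrite -(big_map (fun i => d 0 i) predT (fun z => 'X - z%:P)) mu_prod_XsubC count_map.
rewrite -sum1_count (eq_bigl [in [pred i | d 0 i == c]]) // sum1_card.
rewrite [X in (_ - X)%N](eq_card (B := predC [pred i | d 0 i == c])) => [|i];
  last first.
  by rewrite !inE !mxE subr_eq0.
have := cardC [pred i | d 0 i == c]; rewrite card_ord.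
exact: (canRL (addnK _)).
Qed.

Lemma diagonalizable_mul n (A B : 'M[F]_n) :
  diagonalizable A -> diagonalizable B -> comm_mx A B -> diagonalizable (A *m B).
Proof.
move=> dA dB cAB; have [|P Pu] := (codiagonalizableP [:: A; B]).1; last first.
  case/and3P=> /diagonalizable_forPex[d /(simmxP Pu) PA].
  case/diagonalizable_forPex=> e /(simmxP Pu) PB _.
  exists P => //; apply/diagonalizable_forPex.
  exists (\row_i (d 0 i * e 0 i)); apply/(simmxP Pu).
  by rewrite mulmxA PA -mulmxA PB mulmxA mulmx_diag.
split=> [C D|C]; rewrite !inE; last by case/orP=> /eqP->.
by move=> /orP[] /eqP-> /orP[] /eqP-> //; apply: comm_mx_sym.
Qed.
End Diagonalizable.

(** The matrices act on row vectors, so polynomials in x multiply from the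
    right and the projections to the eigenspaces of s multiply from the left. *)
Section MetacyclicMatrices.
Variables (p a N : nat).
Hypotheses (p_pr : prime p) (a_prim : p.-1.-primitive_root (a%:R : 'F_p)).
Local Notation al := (a%:R : 'F_p).
Variables s t : 'M[algC]_N.+1.
Hypotheses (s_p : s ^+ p = 1) (t_p1 : t ^+ p.-1 = 1) (ts : t * s = s ^+ a * t).
Variables w z : algC.
Hypotheses (w_prim : p.-primitive_root w) (z_prim : p.-1.-primitive_root z).

Let x := s + t.

(** The projection to the eigenspace of s for the eigenvalue w^k. *)
Definition specproj (k : nat) : 'M[algC]_N.+1 :=
  p%:R^-1 *: \sum_(i < p) w ^- (i * k) *: s ^+ i.

Let p_neq0 : p%:R != 0 :> algC.
Proof. by rewrite Num.Theory.pnatr_eq0 -lt0n prime_gt0. Qed.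
Let w_neq0 : w != 0. Proof. exact: prim_root_neq0 w_prim. Qed.

Lemma sum_specproj : \sum_(k < p) specproj k = 1.
Proof.
rewrite -scaler_sumr exchange_big /=.
have h (i : 'I_p) : \sum_(k < p) w ^- (i * k) *: s ^+ i =
    if i == 0%N :> nat then p%:R *: 1 else 0.
  rewrite -scaler_suml; case: eqVneq => [->|i0].
    rewrite (eq_bigr (fun=> 1)) => [|k _]; last by rewrite mul0n expr0 invr1.
    by rewrite sumr_const card_ord expr0.
  have wi : w ^- i != 1.
    rewrite invr_eq1 -(prim_order_dvd w_prim); apply: contra i0 => /dvdn_leq.
    by case: (val i) (ltn_ord i) => // j jp /(_ isT); rewrite leqNgt jp.
  suff -> : \sum_(k < p) w ^- (i * k) = 0 by rewrite scale0r.
  apply: (mulfI (_ : w ^- i - 1 != 0)); first by rewrite subr_eq0.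
  rewrite mulr0 (eq_bigr (fun k : 'I_p => (w ^- i) ^+ k)) => [|k _].
    by rewrite -subrX1 -exprVn -exprM mulnC exprM exprVn (prim_expr_order w_prim)
      invr1 expr1n subrr.
  by rewrite exprM exprVn.
under eq_bigr => i _ do rewrite h.
rewrite -big_mkcond /= (big_pred1 (Ordinal (prime_gt0 p_pr))) => [|i].
  by rewrite scalerA mulVf // scale1r.
by rewrite /= -val_eqE.
Qed.

Lemma specproj_mul k i : specproj k * s ^+ i = w ^+ (k * i) *: specproj k.
Proof.
have h1 : specproj k * s = w ^+ k *: specproj k.
  rewrite /specproj -scalerAl scalerA mulrC -scalerA; congr (_ *: _).
  rewrite mulr_suml scaler_sumr -[in LHS](prednK (prime_gt0 p_pr)).
  rewrite -[in RHS](prednK (prime_gt0 p_pr)) big_ord_recr [in RHS]big_ord_recl /=.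
  rewrite addrC; congr (_ + _).
    rewrite -scalerAl -exprSr prednK ?prime_gt0 // s_p mul0n expr0 invr1 scale1r.
    congr (_ *: _).
    apply: (mulfI (_ : w ^+ (p.-1 * k) != 0)); first exact: expf_neq0.
    rewrite mulfV ?expf_neq0 // -exprD -mulSnr prednK ?prime_gt0 //.
    by rewrite exprM (prim_expr_order w_prim) expr1n.
  apply: eq_bigr => i0 _; rewrite -scalerAl -exprSr scalerA; congr (_ *: _).
  rewrite /bump add1n mulSn exprD invfM mulrA mulfV ?mul1r //.
  exact: expf_neq0.
elim: i => [|i IH]; first by rewrite muln0 !expr0 mulr1 scale1r.
by rewrite exprSr mulrA IH -scalerAl h1 scalerA -exprD mulnS addnC.
Qed.

Lemma tX_s j : t ^+ j * s = s ^+ (a ^ j) * t ^+ j.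
Proof.
have tsX i : t * s ^+ i = s ^+ (a * i) * t.
  elim: i => [|i IH]; first by rewrite muln0 mulr1 mul1r.
  by rewrite exprS mulrA ts -mulrA IH mulrA -exprD mulnS.
elim: j => [|j IH]; first by rewrite mul1r mulr1 expn0.
by rewrite exprS -mulrA IH mulrA tsX -mulrA expnS.
Qed.

(** Since x = s + t, multiplying by t is multiplying by x and subtracting the
    action of s, which after t^j is the scalar w^(k a^j) on the eigenspace. *)
Lemma specproj_tX k j : specproj k * t ^+ j =
  specproj k * horner_mx x (\prod_(l < j) ('X - (w ^+ (k * a ^ l))%:P)).
Proof.
elim: j => [|j IH]; first by rewrite big_ord0 rmorph1.
rewrite big_ord_recr rmorphM /= mulrA -IH rmorphB /= horner_mx_X horner_mx_C.
have Es : specproj k * t ^+ j * s = w ^+ (k * a ^ j) *: (specproj k * t ^+ j).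
  by rewrite -mulrA tX_s mulrA specproj_mul scalerAl.
have Ec c : specproj k * t ^+ j * c%:M = c *: (specproj k * t ^+ j).
  exact: mul_mx_scalar.
by rewrite mulrBr Ec mulrDr Es exprSr mulrA addrAC addrN add0r.
Qed.

(** For k nonzero the eigenvalues w^(k a^l) are all the nontrivial p-th roots
    of unity, and t^(p-1) = 1. *)
Lemma specproj_horner k : (0 < k < p)%N ->
  specproj k * horner_mx x ((\sum_(i < p) 'X^i) - 1) = 0.
Proof.
case/andP=> k0 kp; have wk : p.-primitive_root (w ^+ k).
  by rewrite prim_root_exp_coprime // coprime_sym prime_coprime // gtnNdvd.
have e : \prod_(l < p.-1) ('X - (w ^+ (k * a ^ l))%:P) = \sum_(i < p) 'X^i.
  rewrite -(prod_prim_root p_pr wk) (big_Fp_unit p_pr a_prim).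
  apply: eq_bigr => l _; congr (_ - _%:P); rewrite -natrX val_Fp_nat //.
  by rewrite (prim_expr_mod wk) exprM.
have := specproj_tX k p.-1; rewrite t_p1 mulr1 e => E.
by rewrite rmorphB rmorph1 mulrBr -E mulr1 subrr.
Qed.

Lemma specproj0_horner : specproj 0 * horner_mx x (('X - 1) ^+ p.-1 - 1) = 0.
Proof.
have e : \prod_(l < p.-1) ('X - (w ^+ (0 * a ^ l))%:P) = ('X - 1) ^+ p.-1.
  rewrite (eq_bigr (fun=> 'X - 1)) => [|l _]; last by rewrite mul0n expr0.
  by rewrite prodr_const card_ord.
have := specproj_tX 0 p.-1; rewrite t_p1 mulr1 e => E.
by rewrite rmorphB rmorph1 mulrBr -E mulr1 subrr.
Qed.

(** On the eigenspace of s for 1 the matrix x is annihilated by (X - 1)^(p-1) -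
    1, and on the others by X (X^(p-1) - 1). Both have simple roots, hence so
    has their least common multiple. *)
Lemma metacyclic_diagonalizable : diagonalizable x.
Proof.
have n_gt0 := prim_order_gt0 a_prim.
pose rs1 := [seq 1 + y | y <- prim_powers p.-1 z]; pose rs2 := 0 :: prim_powers p.-1 z.
have u1 : uniq rs1 by rewrite map_inj_uniq ?(uniq_prim_powers z_prim) //; apply: addrI.
have u2 : uniq rs2.
  rewrite /= (uniq_prim_powers z_prim) andbT; apply/mapP => -[i _ /esym/eqP].
  by rewrite (negPf (expf_neq0 _ (prim_root_neq0 z_prim))).
pose rs := undup (rs1 ++ rs2); pose L := \prod_(y <- rs) ('X - y%:P) : {poly algC}.
have dvdL rs' : uniq rs' -> {subset rs' <= rs} ->
    \prod_(y <- rs') ('X - y%:P) %| L.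
  move=> u' sub; apply: uniq_roots_dvdp; last by rewrite uniq_rootsE.
  by apply/allP => y /sub yrs; rewrite root_prod_XsubC.
have EL k : (k < p)%N -> specproj k * horner_mx x L = 0.
  have via (P : {poly algC}) : P %| L ->
      specproj k * horner_mx x P = 0 -> specproj k * horner_mx x L = 0.
    by case/dvdpP=> R ->; rewrite mulrC rmorphM mulrA => ->; rewrite mul0r.
  case: (posnP k) => [k0|k0] kp.
    apply: (via (('X - 1) ^+ p.-1 - 1)); last by rewrite k0 specproj0_horner.
    apply: dvdp_trans (dvdL rs1 u1 _); last first.
      by move=> y yr; rewrite mem_undup mem_cat yr.
    have -> : ('X - 1) ^+ p.-1 - 1 = ('X^(p.-1) - 1) \Po ('X - 1) :> {poly algC}.
      by rewrite rmorphB rmorphXn rmorph1 /= comp_polyX.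
    rewrite /rs1 [X in _ %| X]big_map -(prod_prim_powers z_prim) rmorph_prod.
    rewrite [X in X %| _](eq_bigr (fun y => 'X - (1 + y)%:P)) ?dvdpp // => y _.
    by rewrite rmorphB /= comp_polyX comp_polyC polyCD opprD addrA.
  apply: via (specproj_horner _); last by rewrite k0 kp.
  apply: dvdp_trans (dvdL rs2 u2 _); last first.
    by move=> y yr; rewrite mem_undup mem_cat yr orbT.
  rewrite big_cons (prod_prim_powers z_prim) subr0.
  rewrite -(prednK (prime_gt0 p_pr)) /= big_ord_recl expr0 addrC addKr.
  rewrite (eq_bigr (fun i : 'I_p.-1 => 'X * 'X^i)) => [|i _].
    by rewrite -mulr_sumr subrX1 mulrCA dvdp_mull.
  by rewrite -exprS.
apply/diagonalizableP; exists rs; first exact: undup_uniq.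
apply: mxminpoly_min; rewrite -[LHS]mul1r -sum_specproj mulr_suml.
by rewrite big1 // => k _; apply: EL.
Qed.
End MetacyclicMatrices.

Lemma finite_order_diagonalizable N (th : 'M[algC]_N.+1) (Q : nat) :
  (0 < Q)%N -> th ^+ Q = 1 -> diagonalizable th.
Proof.
move=> Q_gt0 thQ; have [z z_prim] := C_prim_root_exists Q_gt0.
apply/diagonalizableP; exists (prim_powers Q z); first exact: uniq_prim_powers.
rewrite (prod_prim_powers z_prim); apply: mxminpoly_min.
by rewrite rmorphB rmorph1 rmorphXn /= horner_mx_X thQ subrr.
Qed.

Lemma metacyclic_twist_diagonalizable p a N (s t th : 'M[algC]_N) Q :
  prime p -> p.-1.-primitive_root (a%:R : 'F_p) -> (0 < Q)%N ->
  s ^+ p = 1 -> t ^+ p.-1 = 1 -> t * s = s ^+ a * t ->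
  th ^+ Q = 1 -> s * th = th * s -> t * th = th * t ->
  diagonalizable ((s + t) * th).
Proof.
case: N s t th => [|N] s t th p_pr a_prim Q_gt0 s_p t_p1 ts thQ sth tth.
  exists 1%:M; first exact: unitmx1.
  by apply/diagonalizable_forPex; exists 0; apply/eqP/matrixP => -[].
have [w w_prim] := C_prim_root_exists (prime_gt0 p_pr).
have [z z_prim] := C_prim_root_exists (prim_order_gt0 a_prim).
apply: diagonalizable_mul.
- exact: metacyclic_diagonalizable s_p t_p1 ts _ _ w_prim z_prim.
- exact: finite_order_diagonalizable Q_gt0 thQ.
by rewrite /comm_mx -[LHS]/((s + t) * th) -[RHS]/(th * (s + t)) mulrDl mulrDr sth tth.
Qed.

(** * The defect of the layers *)

Section FunctionMatrix.
Variable T : finType.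
Implicit Types f g : T -> T.

(** The permutation matrix convention is that of row vectors, so products of
    matrices compose functions from left to right. *)
Definition fun_mx f : 'M[algC]_#|T| :=
  \matrix_(i, j) (enum_val j == f (enum_val i))%:R.

Lemma fun_mxM f g : fun_mx f * fun_mx g = fun_mx (g \o f).
Proof.
apply/matrixP => i j; rewrite !mxE (bigD1 (enum_rank (f (enum_val i)))) //=.
rewrite !mxE enum_rankK eqxx mul1r big1 ?addr0 // => k kf.
rewrite !mxE; case: eqP => [e|_]; last by rewrite mul0r.
by rewrite -e enum_valK eqxx in kf.
Qed.

Lemma fun_mx1 : fun_mx id = 1.
Proof. by apply/matrixP => i j; rewrite !mxE (inj_eq enum_val_inj) eq_sym. Qed.

Lemma eq_fun_mx f g : f =1 g -> fun_mx f = fun_mx g.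
Proof. by move=> fg; apply/matrixP => i j; rewrite !mxE fg. Qed.

Lemma fun_mxX f n : fun_mx f ^+ n = fun_mx (iter n f).
Proof.
elim: n => [|n IH]; first by rewrite expr0 -fun_mx1.
by rewrite exprSr IH fun_mxM; apply: eq_fun_mx.
Qed.
End FunctionMatrix.

Section LayerDefect.
Variables (p a : nat) (gT : finGroupType) (sigma tau : gT).
Hypotheses (p_pr : prime p) (a_prim : p.-1.-primitive_root (a%:R : 'F_p)).
Hypotheses (sigma_p : (sigma ^+ p = 1)%g) (tau_p1 : (tau ^+ p.-1 = 1)%g)
  (conj_rel : (tau * sigma * tau^-1 = sigma ^+ a)%g) (st : sigma != tau).
Variables (q m : nat).
Hypothesis q_pr : prime q.
Local Notation X := (cayley [set sigma; tau]).
Local Notation T := (gT * Gam q m)%type.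

Let rmul (h : gT) (v : T) : T := ((v.1 * h)%g, v.2).
Let shift (v : T) : T := (v.1, v.2 + theta_ q m).

Let iter_rmul h n v : iter n (rmul h) v = ((v.1 * h ^+ n)%g, v.2).
Proof.
elim: n => [|n IH]; first by case: v => g k; rewrite expg0 mulg1.
by rewrite iterS IH /rmul /= -mulgA -expgSr.
Qed.

Let iter_shift n v : iter n shift v = (v.1, v.2 + theta_ q m *+ n).
Proof.
elim: n => [|n IH]; first by case: v => g k; rewrite mulr0n addr0.
by rewrite iterS IH /shift /= -addrA mulrSr.
Qed.

Lemma layer_adjmx :
  adjmx (layer X q m) = (fun_mx (rmul sigma) + fun_mx (rmul tau)) * fun_mx shift.
Proof.
rewrite mulrDl !fun_mxM; apply/matrixP => i j; rewrite !mxE.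
move: (enum_val i) (enum_val j) => -[g k] w.
rewrite -sum1_card natr_sum.
rewrite (eq_bigl (fun E : edge X * Gam q m => [&& @org X E.1 == g, E.2 == k &
    (@ter X E.1, E.2 + theta_ q m) == w :> T])); last first.
  by move=> [e l]; rewrite inE /= xpair_eqE -andbA.
rewrite big_mkcond -(pair_bigA _ (fun e l => if [&& @org X e == g, l == k &
    (@ter X e, l + theta_ q m) == w :> T] then 1 else 0)) /=.
transitivity (\sum_(e : edge X | org e == g)
    ((ter e, k + theta_ q m) == w :> T)%:R : algC).
  rewrite [RHS]big_mkcond; apply: eq_bigr => e _.
  case: (@org X e == g); last by rewrite big1.
  rewrite (bigD1 k) //= eqxx big1 ?addr0 => [|l /negPf -> //].
  by case: eqP.
rewrite (sum_cayley st (fun x : gT => ((x, k + theta_ q m) == w :> T)%:R : algC)).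
by rewrite !(eq_sym w).
Qed.

Lemma layer_defect : defect (layer X q m) = 0.
Proof.
have n_gt0 := prim_order_gt0 a_prim.
apply/eqP; rewrite /defect subr_eq0; apply/eqP; congr (_%:Z).
apply: diagonalizable_mult; rewrite layer_adjmx.
apply: (@metacyclic_twist_diagonalizable p a _ _ _ _ (q ^ m)) => //.
- by rewrite expn_gt0 prime_gt0.
- rewrite fun_mxX -fun_mx1; apply: eq_fun_mx => -[g k].
  by rewrite iter_rmul sigma_p mulg1.
- rewrite fun_mxX -fun_mx1; apply: eq_fun_mx => -[g k].
  by rewrite iter_rmul tau_p1 mulg1.
- rewrite fun_mxX !fun_mxM; apply: eq_fun_mx => -[g k] /=.
  by rewrite iter_rmul /rmul /= -conj_rel -!mulgA mulVg mulg1.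
- rewrite fun_mxX -fun_mx1; apply: eq_fun_mx => -[g k].
  by rewrite iter_shift theta_order // addr0.
- by rewrite !fun_mxM; apply: eq_fun_mx.
by rewrite !fun_mxM; apply: eq_fun_mx.
Qed.
End LayerDefect.

Theorem proposition3p14
  (p : nat) (p_prime : prime p) (p_gt2 : (2 < p)%N)
  (a : nat) (a_prim : p.-1.-primitive_root (a%:R : 'F_p))
  (gT : finGroupType) (sigma tau : gT)
  (G_pres : ([set: gT] \isog
     Grp (s : t : (s ^+ p, t ^+ p.-1, t * s * t^-1 = s ^+ a)))%g)
  (G_gen : [set: gT] = <<[set sigma; tau]>>%g)
  (sigma_p : (sigma ^+ p = 1)%g)
  (tau_p1 : (tau ^+ p.-1 = 1)%g)
  (conj_rel : (tau * sigma * tau^-1 = sigma ^+ a)%g) :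
  forall q : nat, prime q ->
  (forall m : nat,
     defect (layer (cayley [set sigma; tau]) q m) = 0) /\
  iwasawa_invariants (BF_inf q (cayley [set sigma; tau])) 0
    (if q %| p.-1 then p.-1 * (q ^ logn q p.-1 - 1) else 0)%N.
Proof.
move=> q q_pr.
have st : sigma != tau by apply: sigma_neq_tau G_gen sigma_p tau_p1 conj_rel.
split=> [m|].
  exact: (layer_defect p_prime a_prim sigma_p tau_p1 conj_rel st).
have -> : (if q %| p.-1 then p.-1 * (q ^ logn q p.-1 - 1) else 0)%N =
    (p.-1 * (q ^ logn q p.-1 - 1))%N.
  case: ifPn => // nq; suff -> : logn q p.-1 = 0%N by rewrite muln0.
  by apply/eqP; rewrite -leqn0 leqNgt logn_gt0 mem_primes q_pr (negPf nq) andbF.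
exact: BF_invariants G_pres G_gen sigma_p tau_p1 conj_rel q q_pr.
Qed.
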